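(* Let $p,q,r\in[0,1]$ with $p+q+r=1$ and $0<r<1$, let $s\in[0,1]$, and let $(S_n)$ be the elephant random walk with stops (ERWS) with parameters $p,q,r,s$, with number of ones $\Sigma_n=\sum_{k=1}^nX_k^2$. Assume the diffusive regime $\frac{p}{1-r}<\frac34$ and set $\sigma_r^2=\frac{1-r}{3(1-r)-4p}$. Then, as $n\to\infty$, one has the convergence in distribution $$\frac{S_n}{\sqrt{\Sigma_n}}\xrightarrow{\ \mathcal{L}\ }\mathcal{N}(0,\sigma_r^2).$$ Moreover, $$\frac{S_n}{\sqrt{n^{1-r}}}\xrightarrow{\ \mathcal{L}\ }\sqrt{\Sigma'}\,\mathcal{N}(0,\sigma_r^2),$$ where $\Sigma'$ is independent of the Gaussian $\mathcal{N}(0,\sigma_r^2)$ random variable and $\Sigma'$ has a Mittag-Leffler distribution with parameter $1-r$.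
   Context: The elephant random walk with stops (ERWS) is defined as follows. The parameters are $p,q,r\in[0,1]$ with $p+q+r=1$, where $0<r<1$ is assumed throughout, and $s\in[0,1]$. The first step $X_1$ equals $+1$ with probability $s$ and $-1$ with probability $1-s$. For each $n\ge 1$, given $X_1,\dots,X_n$, an integer $k$ is chosen uniformly at random in $\{1,\dots,n\}$ and, independently of this choice and of the past, $X_{n+1}=X_k$ with probability $p$, $X_{n+1}=-X_k$ with probability $q$, and $X_{n+1}=0$ with probability $r$. The position of the ERWS is $S_0=0$ and $S_n=\sum_{k=1}^n X_k$ for $n\ge1$. The number of ones up to time $n$ is $\Sigma_n=\sum_{k=1}^n X_k^2$ (note $\Sigma_n\ge\Sigma_1=1$). A random variable $X$ has a Mittag-Leffler distribution with parameter $\alpha\in(0,1]$ if $\mathbb{E}[\exp(tX)]=\sum_{n=0}^\infty \frac{t^n}{\Gamma(1+n\alpha)}$ for all $t\in\mathbb{R}$; equivalently $\mathbb{E}[X^m]=\frac{m!}{\Gamma(1+m\alpha)}$ for all integers $m\ge1$ (these moments characterize the distribution). $\xrightarrow{\mathcal{L}}$ denotes convergence in distribution and $\mathcal{N}(0,v)$ the centered Gaussian law with variance $v$. *)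

(* Defs.v *)
From HB Require Import structures.
From mathcomp Require Import all_boot all_order all_algebra.
From mathcomp Require Import all_classical all_reals all_analysis.

Set Implicit Arguments.
Unset Strict Implicit.
Unset Printing Implicit Defensive.

Import Order.TTheory GRing.Theory Num.Theory.
Import numFieldNormedType.Exports.

Local Open Scope classical_set_scope.
Local Open Scope ring_scope.

(* Law of the factor by which the remembered step is multiplied:
   keep it (1), flip it (-1) or stop (0). *)
Definition step_law (R : realType) (p q r a : R) : R :=
  if a == 1 then p else if a == -1 then q else if a == 0 then r else 0.

(* The event that the trajectory X_1, ..., X_n is x_1, ..., x_n. *)
Definition past (R : realType) d (T : measurableType d)
    (X : nat -> T -> R) (n : nat) (x : nat -> R) : set T :=
  [set w | forall i, (1 <= i <= n)%N -> X i w = x i].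

(* Elephant random walk with stops.  Steps are numbered from 1; [X 0] is
   unused and unconstrained.  [K n] is the time remembered when choosing
   the step n+1 and [xi n] is the factor applied to it: given X_1, ..., X_n,
   they are independent, with [K n] uniform on {1, ..., n} and [xi n] of law
   [step_law p q r].  As the masses over 1 <= k <= n and a \in {1, -1, 0} sum
   to the probability of the past, this determines their conditional law. *)
Definition is_ERWS (R : realType) (p q r s : R) d (T : measurableType d)
    (P : probability T R) (X : nat -> {RV P >-> R}) : Prop :=
  [/\ P [set w | X 1%N w = 1] = s%:E,
      P [set w | X 1%N w = -1] = (1 - s)%:E
    & exists (K : nat -> {RV P >-> nat}) (xi : nat -> {RV P >-> R}),
      forall n : nat, (1 <= n)%N ->
        (forall w, X n.+1 w = xi n w * X (K n w) w) /\
        (forall (x : nat -> R) (k : nat) (a : R), (1 <= k <= n)%N ->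
          P (past (fun i => X i) n x `&`
              [set w | K n w = k] `&` [set w | xi n w = a]) =
          (P (past (fun i => X i) n x) *
            (n%:R^-1 * step_law p q r a)%:E)%E)].

Definition position (R : realType) (T : Type) (X : nat -> T -> R)
    (n : nat) (w : T) : R :=
  \sum_(1 <= k < n.+1) X k w.

Definition number_of_ones (R : realType) (T : Type) (X : nat -> T -> R)
    (n : nat) (w : T) : R :=
  \sum_(1 <= k < n.+1) X k w ^+ 2.

(* The Euler integral; only meaningful for 0 < x. *)
Definition Gamma (R : realType) (x : R) : R :=
  \int[@lebesgue_measure R]_(t in `]0, +oo[) (t `^ (x - 1) * expR (- t)).

(* The series converges absolutely for 0 < alpha, so that its [limn] is
   its sum. *)
Definition mittag_leffler (R : realType) (alpha : R) d (T : measurableType d)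
    (P : probability T R) (Y : {RV P >-> R}) : Prop :=
  forall t : R, 'M_P Y t =
    (limn (series (fun n => t ^+ n / Gamma (1 + n%:R * alpha))))%:E.

Definition independent_RV (R : realType) d (T : measurableType d)
    (P : probability T R) (Y Z : {RV P >-> R}) : Prop :=
  forall A B : set R, measurable A -> measurable B ->
    P (Y @^-1` A `&` Z @^-1` B) = (P (Y @^-1` A) * P (Z @^-1` B))%E.

Definition has_law (R : realType) d (T : measurableType d)
    (P : probability T R) (Y : {RV P >-> R}) (mu : set R -> \bar R) : Prop :=
  forall A : set R, measurable A -> distribution P Y A = mu A.

(* Convergence in distribution of the Y_n, defined on (T, P), to Z, defined
   on a possibly different probability space (T', P'). *)
Definition cvg_in_law (R : realType) d (T : measurableType d)
    (P : probability T R) (Y : nat -> T -> R)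
    d' (T' : measurableType d') (P' : probability T' R) (Z : T' -> R) : Prop :=
  forall f : R -> R, continuous f -> (exists M : R, forall x, `|f x| <= M) ->
    (fun n => ('E_P[f \o Y n])%E) @ \oo --> ('E_P'[f \o Z])%E.

Definition sigma2 (R : realType) (p r : R) : R :=
  (1 - r) / (3 * (1 - r) - 4 * p).

(* Main.v *)
Require Import Defs.
From HB Require Import structures.
From mathcomp Require Import all_boot all_order all_algebra.
From mathcomp Require Import ring lra zify.
From mathcomp Require Import all_classical all_reals all_analysis.
From mathcomp Require Import measurable_realfun.

(** A step that recalls a zero is itself a zero, so the times at which the
    walk moves and the signs of its moves decouple. Conditionally on moving, the
    recalled step is uniform among the earlier nonzero ones; hence
    $S_n = W_{\Sigma_n}$ in law, where $W$ is an elephant random walk without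
    stops, of memory parameter $p / (1 - r)$, and $W$ is independent of the
    number of ones [chain_mean_walk]. With $c = (p - q) / (p + q)$ and
    $\alpha = p + q = 1 - r$, the diffusive condition says $c < 1/2$, and
    $\sigma_r^2 = 1 / (1 - 2 c)$.

    Both limits are proved by moments.

    - The $k$-th moment of $W_m$ obeys a recursion
      $x_{m+1} = (1 + c k / m) x_m + b_m$ in which $b_m$ only involves lower
      moments, the one of order $k - 2$ being dominant. Divided by $m^{k/2}$ it
      converges to a limit $g_k = (k - 1) \sigma_r^2 g_{k-2}$: these are the
      Gaussian moments [walk_moment_cvg].
    - Rising factorials are eigenfunctions of the growth of $\Sigma_n$, which
      gains one with conditional probability $\alpha \Sigma_n / n$. Their
      expectations are the products $k! \prod_i (1 + k \alpha / i)$, and the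
      Gauss product for the Gamma function gives
      $E[\Sigma_n^k] \sim n^{k \alpha} k! / \Gamma(1 + k \alpha)$
      [power_moment_cvg].

    Since $\Sigma_n \to \infty$, conditioning on $\Sigma_n$ yields the limits
    of the moments of $S_n / \sqrt{\Sigma_n}$, and those of
    $S_n / \sqrt{n^\alpha}$ as a product of a Gaussian moment and a
    Mittag-Leffler moment of half the order.

    The limit variables have these moments: those of a Gaussian or
    Mittag-Leffler variable are read off the expansion at $0$ of its moment
    generating function [taylor_coefficients_unique], and independence
    multiplies expectations, by Fubini's theorem. Finally the even moments of the
    limits are $o((2K)! / t^{2K})$ for every $t$, so the Taylor polynomials of
    $\cos(t x)$ and $\sin(t x)$ approximate these functions in mean; convergence
    of moments then gives convergence of trigonometric means, and a bounded
    continuous function is approximated by polynomials in a slow sine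
    [method_of_moments]. *)

Import Order.TTheory GRing.Theory Num.Theory.
Import numFieldNormedType.Exports.

Set Implicit Arguments.
Unset Strict Implicit.
Unset Printing Implicit Defensive.

Local Open Scope classical_set_scope.
Local Open Scope ring_scope.

(** * Linear recursions with vanishing relaxation rate *)

(** The factors [1 - eta / n] multiply to [0] because the harmonic series
    diverges. Comparing [v n] with [1 / (1 + eta * H n)], where [H] is the
    harmonic sum, makes this an induction. *)
Lemma cvg_to0_of_contraction (R : realType) (eta : R) (N : nat)
    (v : nat -> R) : 0 < eta -> (forall n, 0 <= v n) ->
  (forall n, (N <= n)%N -> v n.+1 <= (1 - eta / n.+1%:R) * v n) ->
  v n @[n --> \oo] --> (0 : R).
Proof.
move=> eta0 v0 vS.
pose H := series (@harmonic R).
have HS n : H n.+1 = H n + n.+1%:R^-1 by rewrite /H seriesSr.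
have Hnd : nondecreasing_seq H.
  by apply/nondecreasing_seqP => n; rewrite HS lerDl invr_ge0 ler0n.
have Hoo : H n @[n --> \oo] --> +oo%R.
  exact: nondecreasing_dvgn_lt Hnd (@dvg_harmonic R).
have bound n : (N <= n)%N -> v n * (1 + eta * (H n - H N)) <= v N.
  elim: n => [|n IH]; first by rewrite leqn0 => /eqP <-; rewrite subrr mulr0 addr0 mulr1.
  rewrite leq_eqVlt => /predU1P[<-|]; first by rewrite subrr mulr0 addr0 mulr1.
  rewrite ltnS => Nn; apply: le_trans (IH Nn).
  have h : 0 <= eta * (H n - H N) by apply: mulr_ge0; rewrite ?subr_ge0 ?Hnd// ltW.
  rewrite HS; set u := eta / n.+1%:R.
  have u0 : 0 <= u by rewrite divr_ge0 ?ler0n// ltW.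
  rewrite (_ : 1 + _ = 1 + eta * (H n - H N) + u); last by rewrite /u; ring.
  set S := eta * _ in h *.
  apply: (@le_trans _ _ ((1 - u) * v n * (1 + S + u))).
    by rewrite ler_wpM2r// ?vS//; lra.
  rewrite -subr_ge0 (_ : _ - _ = v n * (u * (S + u))); last by ring.
  by apply: mulr_ge0 => //; apply: mulr_ge0 => //; apply: addr_ge0.
have : (fun n => v N / (1 + eta * (H n - H N))) @ \oo --> (0 : R).
  rewrite -[0](mulr0 (v N)); apply: cvgM; first exact: cvg_cst.
  apply/gtr0_cvgV0; last first.
    apply/cvgryPge => A.
    near=> n.
    have : H N + A / eta <= H n.
      near: n; move/cvgryPge : Hoo; exact.
    rewrite -lerBrDl ler_pdivrMr// => hh; nra.
  near=> n.
  have : H N <= H n by near: n; move/cvgryPge : Hoo; exact.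
  rewrite -subr_ge0 => hh; nra.
apply: squeeze_cvgr; last exact: cvg_cst.
near=> n; rewrite v0/=.
have hn : H N <= H n by near: n; move/cvgryPge : Hoo; exact.
rewrite ler_pdivlMr; last by move: hn; rewrite -subr_ge0 => hn; nra.
apply: bound; near: n; exact: nbhs_infty_ge.
Unshelve. all: by end_near. Qed.

Lemma cvg_n_dividedby_succ (R : realType) :
  (fun n : nat => n%:R / n.+1%:R : R) @ \oo --> (1 : R).
Proof.
apply: cvg_trans (_ : (fun n => 1 - @harmonic R n) @ \oo --> _).
  apply: near_eq_cvg; near=> n.
  by rewrite /harmonic/= -[n.+1%:R]natr1; field; rewrite natr1.
rewrite -[X in _ --> X]subr0.
by apply: cvgB; [exact: cvg_cst|exact: cvg_harmonic].
Unshelve. all: by end_near. Qed.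

Lemma cvg_sqrt_ratio (R : realType) :
  (fun n : nat => Num.sqrt n%:R / Num.sqrt n.+1%:R : R) @ \oo --> (1 : R).
Proof.
have -> : (fun n : nat => Num.sqrt n%:R / Num.sqrt n.+1%:R : R) =
          (fun n : nat => Num.sqrt (n%:R / n.+1%:R)).
  by apply/funext => n; rewrite sqrtrM ?ler0n// sqrtrV ?ler0n.
rewrite -[X in _ --> X]sqrtr1.
apply: (@continuous_cvg _ _ _ _ _ _ (@Num.sqrt R)); last exact: cvg_n_dividedby_succ.
exact: sqrt_continuous.
Qed.

(** First-order expansion of $(n / (n + 1))^{k/2}$: from $k$ to $k + 1$,
    $1 - \rho^{k+1} = (1 - \rho) + \rho (1 - \rho^k)$. *)
Lemma cvg_sqrt_ratio_rate (R : realType) (k : nat) :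
  (fun n : nat => n%:R * (1 - (Num.sqrt n%:R / Num.sqrt n.+1%:R : R) ^+ k))
    @ \oo --> (k%:R / 2 : R).
Proof.
pose rho n : R := Num.sqrt n%:R / Num.sqrt n.+1%:R.
have rho0 n : 0 <= rho n by rewrite divr_ge0 ?sqrtr_ge0.
have base : (fun n : nat => n%:R * (1 - rho n)) @ \oo --> (2^-1 : R).
  have -> : (fun n : nat => n%:R * (1 - rho n)) =
            (fun n => (n%:R / n.+1%:R) * (1 + rho n)^-1).
    apply/funext => n.
    have d0 : 1 + rho n != 0 by rewrite gt_eqF// ltr_pwDl.
    apply: (mulIf d0); rewrite mulfVK// -mulrA.
    have -> : (1 - rho n) * (1 + rho n) = 1 - rho n ^+ 2 by ring.
    rewrite /rho expr_div_n !sqr_sqrtr ?ler0n// -[n.+1%:R]natr1.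
    by field; rewrite natr1.
  rewrite -[2^-1]mul1r; apply: cvgM; first exact: cvg_n_dividedby_succ.
  apply: cvgV; first by rewrite pnatr_eq0.
  by apply: cvgD; [exact: cvg_cst|exact: cvg_sqrt_ratio].
elim: k => [|k IH].
  rewrite mul0r [X in X @ _](_ : _ = fun=> 0); first exact: cvg_cst.
  by apply/funext => n; rewrite expr0 subrr mulr0.
rewrite [X in X @ _](_ : _ =
    fun n => n%:R * (1 - rho n) + rho n * (n%:R * (1 - rho n ^+ k))); last first.
  by apply/funext => n; rewrite exprS -/(rho n); ring.
rewrite (_ : _ / 2 = 2^-1 + 1 * (k%:R / 2)); last by rewrite -natr1; field.
by apply: cvgD => //; apply: cvgM => //; exact: cvg_sqrt_ratio.
Qed.

(** A source [b m] equivalent to $\beta m^{k/2 - 1}$ forces a solution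
    equivalent to $l m^{k/2}$ with $(k/2) l = a l + \beta$. After normalisation
    the distance to [l] contracts by about $1 - (k/2 - a) / m$ at each step, up
    to an error $o(1/m)$. *)
Lemma cvg_linear_recursion (R : realType) (k : nat) (a beta : R)
    (x b : nat -> R) : a < k%:R / 2 ->
  (forall m, (0 < m)%N -> x m.+1 = (1 + a / m%:R) * x m + b m) ->
  (fun m => b m * m%:R / Num.sqrt m%:R ^+ k) @ \oo --> beta ->
  (fun m => x m / Num.sqrt m%:R ^+ k) @ \oo --> beta / (k%:R / 2 - a).
Proof.
move=> ak xS bcvg; set gam := _ - a.
have gam0 : 0 < gam by rewrite subr_gt0.
set l := beta / gam.
pose rho n : R := Num.sqrt n%:R / Num.sqrt n.+1%:R.
pose y m := x m / Num.sqrt m%:R ^+ k.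
pose bb m := b m * m%:R / Num.sqrt m%:R ^+ k.
pose th m := m%:R * (1 - rho m ^+ k) - rho m ^+ k * a.
pose e m := bb m * rho m ^+ k - th m * l.
have rhok : (fun m => rho m ^+ k) @ \oo --> (1 : R).
  rewrite -[X in _ --> X](expr1n R k).
  apply: (@continuous_cvg _ _ _ _ _ _ (fun z : R => z ^+ k)) (@cvg_sqrt_ratio R).
  exact: exprn_continuous.
have thcvg : th @ \oo --> gam.
  rewrite /gam -[a in X in _ --> X]mul1r; apply: cvgB.
    exact: cvg_sqrt_ratio_rate.
  by apply: cvgM => //; exact: cvg_cst.
have ecvg : e @ \oo --> (0 : R).
  have -> : 0 = beta * 1 - gam * l.
    by rewrite /l mulrCA divff ?gt_eqF// mulr1 subrr.
  by apply: cvgB; apply: cvgM => //; exact: cvg_cst.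
have zS m : (0 < m)%N -> y m.+1 - l = (1 - th m / m%:R) * (y m - l) + e m / m%:R.
  move=> m0; rewrite /e /th /bb /y xS// /rho.
  have sm : Num.sqrt m%:R != 0 :> R by rewrite gt_eqF// sqrtr_gt0 ltr0n.
  have sm1 : Num.sqrt m.+1%:R != 0 :> R by rewrite gt_eqF// sqrtr_gt0 ltr0n.
  rewrite expr_div_n; set s := Num.sqrt m%:R ^+ k; set s1 := _ ^+ k.
  have s0 : s != 0 by rewrite expf_neq0.
  have s10 : s1 != 0 by rewrite expf_neq0.
  by field; rewrite s0 s10 pnatr_eq0 -lt0n m0.
apply/cvgrPdist_le => eps eps0.
(* Subtracting [eps / 2] before truncating absorbs the o(1/m) error, so that
   [v] contracts without source. *)
pose v m := Num.max 0 (`|y m - l| - eps / 2).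
have : v @ \oo --> (0 : R).
  have near1 : \forall m \near \oo, [/\ gam / 2 <= th m, th m <= 2 * gam,
      2 * gam <= m%:R & `|e m| <= eps * gam / 4].
    near=> m; split.
    - by near: m; apply: (cvgr_ge gam) => //; rewrite ltr_pdivrMr// ltr_pMr// ltr1n.
    - by near: m; apply: (cvgr_le gam) => //; rewrite ltr_pMl// ltr1n.
    - by near: m; exact: nbhs_infty_ger.
    - near: m; move/cvgr0Pnorm_le : ecvg; apply.
      by rewrite divr_gt0// mulr_gt0.
  case: near1 => N _ hN.
  apply: (@cvg_to0_of_contraction _ (gam / 2) N.+1).
  - by rewrite divr_gt0.
  - by move=> m; rewrite /v le_max lexx.
  move=> m Nm.
  have m0 : (0 < m)%N by exact: leq_ltn_trans Nm.
  have mR : 0 < m%:R :> R by rewrite ltr0n.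
  have [th1 th2 gm em] := hN m (ltnW Nm).
  have c0 : 0 <= 1 - gam / 2 / m%:R.
    by rewrite subr_ge0 ler_pdivrMr// mul1r; lra.
  have c1 : 1 - gam / 2 / m%:R <= 1 - gam / 2 / m.+1%:R.
    by rewrite lerB// ler_pM2l ?divr_gt0// lef_pV2 ?posrE ?ltr0n// ler_nat.
  have v0 : 0 <= v m by rewrite le_max lexx.
  apply: (@le_trans _ _ ((1 - gam / 2 / m%:R) * v m)); last first.
    exact: ler_wpM2r.
  rewrite {1}/v ge_max mulr_ge0//=.
  apply: (@le_trans _ _ ((1 - gam / 2 / m%:R) * (`|y m - l| - eps / 2))); last first.
    by rewrite ler_wpM2l// /v le_max lexx orbT.
  rewrite zS// lerBlDr; apply: le_trans (ler_normD _ _) _.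
  rewrite !normrM (ger0_norm (_ : 0 <= m%:R^-1)) ?invr_ge0//.
  rewrite (ger0_norm (_ : 0 <= 1 - th m / m%:R)); last first.
    by rewrite subr_ge0 ler_pdivrMr// mul1r; lra.
  set A := `|y m - l|; have A0 : 0 <= A by rewrite normr_ge0.
  apply: (@le_trans _ _ ((1 - gam / 2 / m%:R) * A + eps * gam / 4 / m%:R)).
    apply: lerD; last by rewrite ler_wpM2r ?invr_ge0.
    by rewrite ler_wpM2r// lerB// ler_wpM2r ?invr_ge0.
  by rewrite le_eqVlt; apply/orP; left; apply/eqP; field; rewrite gt_eqF.
move=> /cvgr0Pnorm_le vcvg.
near=> m.
have : `|v m| <= eps / 2 by near: m; apply: vcvg; rewrite divr_gt0.
rewrite ger0_norm ?le_max ?lexx// /v ge_max => /andP[_].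
by rewrite lerBlDr -splitr distrC.
Unshelve. all: by end_near. Qed.

(** * Taylor remainders of cosine and sine *)

Section trigonometric_remainders.
Variable R : realType.
Implicit Types (F G : R -> R) (x y : R) (n k K : nat).

Definition taylor_monomial n x : R := x ^+ n / n`!%:R.

Lemma is_derive_taylor_monomial n x :
  is_derive x 1 (taylor_monomial n.+1) (taylor_monomial n x).
Proof.
have -> : taylor_monomial n.+1 = (n.+1`!%:R)^-1 *: ((@id R) ^+ n.+1).
  by apply/funext => y; rewrite /taylor_monomial !fctE mulrC.
apply: is_derive_eq; rewrite /taylor_monomial factS natrM /=.
rewrite [_%:A]/GRing.scale/= mulr1 [LHS]/GRing.scale/= mulrA.
by field; rewrite -[1 + _]/(1%:R + _) -natrD !pnatr_eq0 -lt0n fact_gt0.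
Qed.

Lemma integrated_bound F G n : (forall x, is_derive x 1 F (G x)) -> F 0 = 0 ->
  (forall x, 0 <= x -> G x <= taylor_monomial n x) ->
  forall x, 0 <= x -> F x <= taylor_monomial n.+1 x.
Proof.
move=> FG F0 Gn x x0.
pose D := taylor_monomial n.+1 - F.
have DD y : is_derive y 1 D (taylor_monomial n y - G y).
  have h1 := is_derive_taylor_monomial n y; have h2 := FG y. exact: (is_deriveB h1 h2).
have DC : {within `[0, x], continuous D}.
  by apply: derivable_within_continuous => y _; apply: (@ex_derive _ _ _ _ _ _ _ (DD y)).
have [c] := MVT_segment x0 (fun y _ => DD y) DC.
rewrite in_itv/= => /andP[c0 _].
rewrite subr0 /D !fctE F0 {2}/taylor_monomial expr0n mul0r !subr0 => Dx.
by rewrite -subr_ge0 Dx mulr_ge0// subr_ge0 Gn.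
Qed.

(** Reflections of the values and of the argument reduce this to the one-sided
    bound on the half line. *)
Lemma norm_integrated_bound F G n : (forall x, is_derive x 1 F (G x)) ->
  F 0 = 0 -> (forall x, `|G x| <= taylor_monomial n `|x|) ->
  forall x, `|F x| <= taylor_monomial n.+1 `|x|.
Proof.
move=> FG F0 Gn.
have Fpos x : 0 <= x -> `|F x| <= taylor_monomial n.+1 x.
  move=> x0; rewrite ler_norml lerNl; apply/andP; split.
    apply: (@integrated_bound (- F) (- G)) => //.
    - by rewrite -[LHS]/(- F 0) F0 oppr0.
    - move=> y y0; have := Gn y; rewrite (ger0_norm y0); apply: le_trans.
      by rewrite -[leLHS]/(- G y) -normrN ler_norm.
  apply: (integrated_bound FG) => // y y0.
  by have := Gn y; rewrite (ger0_norm y0); apply: le_trans; exact: ler_norm.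
have Fneg x : 0 <= x -> `|F (- x)| <= taylor_monomial n.+1 x.
  have dF y : is_derive y 1 (F \o -%R) (- G (- y)).
    have ? := FG (- y).
    have : is_derive y (1 : R) (F \o -%R) (G (- y) * -1).
      by apply: is_derive1_comp.
    by rewrite mulrN1.
  have Gb y : 0 <= y -> `|G (- y)| <= taylor_monomial n y.
    by move=> y0; have := Gn (- y); rewrite normrN (ger0_norm y0).
  move=> x0; rewrite ler_norml lerNl; apply/andP; split.
    apply: (@integrated_bound (- (F \o -%R)) (fun y => G (- y))) => //.
    - move=> y; have ? := dF y; rewrite -[G _]opprK; exact: is_deriveN.
    - by rewrite -[LHS]/(- F (- 0)) oppr0 F0 oppr0.
    - by move=> y /Gb; apply: le_trans; exact: ler_norm.
  apply: (integrated_bound dF) => //.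
  - by rewrite /= oppr0.
  - by move=> y /Gb; apply: le_trans; rewrite -normrN ler_norm.
move=> x; have [x0|] := boolP (0 <= x); first by rewrite (ger0_norm x0) Fpos.
rewrite -ltNge => /ltW x0; rewrite (ler0_norm x0) -{1}[x]opprK.
by apply: Fneg; rewrite oppr_ge0.
Qed.

Definition cos_remainder K x : R :=
  cos x - \sum_(k < K) (-1) ^+ k * taylor_monomial k.*2 x.
Definition sin_remainder K x : R :=
  sin x - \sum_(k < K) (-1) ^+ k * taylor_monomial k.*2.+1 x.

Lemma cos_remainderS K :
  cos_remainder K.+1 = cos_remainder K - (-1) ^+ K *: taylor_monomial K.*2.
Proof.
by apply/funext => x; rewrite /cos_remainder !fctE big_ord_recr/= opprD addrA.
Qed.

Lemma sin_remainderS K :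
  sin_remainder K.+1 = sin_remainder K - (-1) ^+ K *: taylor_monomial K.*2.+1.
Proof.
by apply/funext => x; rewrite /sin_remainder !fctE big_ord_recr/= opprD addrA.
Qed.

Lemma cos_remainder0 : cos_remainder 0 = cos.
Proof. by apply/funext => x; rewrite /cos_remainder big_ord0 subr0. Qed.

Lemma sin_remainder0 : sin_remainder 0 = sin.
Proof. by apply/funext => x; rewrite /sin_remainder big_ord0 subr0. Qed.

Lemma is_derive_sin_remainder K x :
  is_derive x 1 (sin_remainder K) (cos_remainder K x).
Proof.
elim: K => [|K IH]; first by rewrite sin_remainder0 cos_remainder0; exact: is_derive_sin.
rewrite sin_remainderS cos_remainderS !fctE.
have ? := is_derive_taylor_monomial K.*2 x.
by apply: is_deriveB.
Qed.

Lemma is_derive_cos_remainder K x :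
  is_derive x 1 (cos_remainder K.+1) (- sin_remainder K x).
Proof.
elim: K => [|K IH].
  rewrite cos_remainderS cos_remainder0 sin_remainder0.
  have -> : cos - (-1) ^+ 0 *: taylor_monomial 0.*2 = cos - cst (1:R).
    by apply/funext => y; rewrite !fctE /taylor_monomial !expr0 divr1 scale1r.
  rewrite -[- sin x]subr0; apply: is_deriveB.
have dm := is_derive_taylor_monomial K.*2.+1 x.
have := is_deriveB IH (is_deriveZ ((-1) ^+ K.+1) dm).
rewrite -cos_remainderS; congr is_derive.
rewrite /sin_remainder big_ord_recr/= exprS /GRing.scale/=; ring.
Qed.

Lemma sin_remainder_at0 K : sin_remainder K 0 = 0.
Proof.
rewrite /sin_remainder sin0 big1 ?subr0// => k _.
by rewrite /taylor_monomial expr0n mul0r mulr0.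
Qed.

Lemma cos_remainder_at0 K : cos_remainder K.+1 0 = 0.
Proof.
rewrite /cos_remainder cos0 big_ord_recl big1 ?addr0 => [|k _].
  by rewrite /taylor_monomial !expr0 divr1 mulr1 subrr.
by rewrite /taylor_monomial expr0n mul0r mulr0.
Qed.

(** Each remainder is a primitive, vanishing at [0], of the previous one, up to
    sign; so the bound [`|cos x| <= 1] is integrated repeatedly. *)
Lemma norm_cos_remainder K x : `|cos_remainder K x| <= taylor_monomial K.*2 `|x|.
Proof.
elim: K x => [x|K IH]; first by rewrite cos_remainder0 /taylor_monomial expr0 divr1 cos_max.
have := norm_integrated_bound (is_derive_sin_remainder K) (sin_remainder_at0 K) IH.
move=> sinB; apply: (norm_integrated_bound (is_derive_cos_remainder K)).
  exact: cos_remainder_at0.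
by move=> x; rewrite normrN.
Qed.

(** The exponent is even, one below the sharp one, because the moments of even
    order are those whose growth is controlled later. *)
Lemma norm_sin_remainder K x : `|sin_remainder K x| <= taylor_monomial K.*2 `|x|.
Proof.
elim: K x => [x|K IH]; first by rewrite sin_remainder0 /taylor_monomial expr0 divr1 sin_max.
apply: (norm_integrated_bound (is_derive_sin_remainder K.+1)).
  exact: sin_remainder_at0.
apply: (norm_integrated_bound (is_derive_cos_remainder K)).
  exact: cos_remainder_at0.
by move=> x; rewrite normrN.
Qed.

End trigonometric_remainders.

(** * Bernstein approximation *)

Section bernstein.
Variable R : realType.
Implicit Types (x a : R) (n k : nat).

(** The mean of [g] under the binomial law of [n] trials of success probability
    [x]. Conditioning on one trial makes linearity, positivity and the second
    moment immediate inductions. *)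
Fixpoint bernstein n x (g : nat -> R) : R :=
  if n is m.+1 then x * bernstein m x (g \o S) + (1 - x) * bernstein m x g
  else g 0%N.

Lemma bernstein_linear n x a (g h : nat -> R) :
  bernstein n x (fun k => a * g k + h k) = a * bernstein n x g + bernstein n x h.
Proof.
elim: n g h => [//|n IH] g h /=; rewrite IH (_ : _ \o _ = (fun k => a * (g \o S) k + (h \o S) k))//.
by rewrite IH; ring.
Qed.

Lemma bernstein_cst n x a : bernstein n x (fun=> a) = a.
Proof.
elim: n => [//|n IH] /=.
by rewrite [X in _ * bernstein _ _ X](_ : _ = fun=> a)// IH; ring.
Qed.

Lemma le_bernstein n x (g h : nat -> R) : 0 <= x <= 1 ->
  (forall k, g k <= h k) -> bernstein n x g <= bernstein n x h.
Proof.
move=> /andP[x0 x1]; elim: n g h => [|n IH] g h gh /=; first exact: gh.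
by apply: lerD; (rewrite ler_wpM2l ?subr_ge0 ?IH//) => k /=.
Qed.

Lemma bernstein_square n x a :
  bernstein n x (fun k => (k%:R + a) ^+ 2) =
  (n%:R * x + a) ^+ 2 + n%:R * (x * (1 - x)).
Proof.
elim: n a => [|n IH] a /=; first by rewrite !mul0r addr0.
rewrite (_ : _ \o _ = fun k => (k%:R + (1 + a)) ^+ 2); last first.
  by apply/funext => k /=; rewrite -natr1 addrA.
by rewrite !IH -natr1; ring.
Qed.

(** Only [x] is confined to the compact, because [bernstein] evaluates [g] at
    all [k / n], also beyond [1]. *)
Lemma unif_continuous_near_compact (g : R -> R) (K : set R) : continuous g ->
  compact K -> forall e, 0 < e -> exists2 d : R, 0 < d &
    forall x y, K x -> `|x - y| < d -> `|g x - g y| < e.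
Proof.
move=> cg /compact_near_coveringP cK e e0.
pose P (d x : R) := forall y, `|x - y| < d -> `|g x - g y| < e.
have {cK} H := @cK R (0 : R)^'+ P _.
have {H} : \forall d \near (0:R)^'+, K `<=` P d.
  apply: H => x Kx.
  have /cvgrPdist_lt /(_ (e / 2)) := cg x.
  rewrite divr_gt0// => /(_ isT) /nbhs_ballP[d /= d0 hd].
  exists (ball x (d / 2), [set t | t < d / 2]) => /=.
    split; first by apply: nbhsx_ballx; rewrite divr_gt0.
    by near do idtac; apply: nbhs_right_lt; rewrite divr_gt0.
  move=> [x' t] /= [xx' td] y x'y.
  have h1 := hd x'; have h2 := hd y.
  have xx'd : `|x - x'| < d by apply: lt_le_trans xx' _; lra.
  have xyd : `|x - y| < d.
    rewrite (_ : x - y = (x - x') + (x' - y)); last by ring.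
    apply: le_lt_trans (ler_normD _ _) _.
    have : `|x - x'| < d / 2 by [].
    lra.
  have /= := h1 xx'd; have /= := h2 xyd => u v.
  rewrite (_ : g x' - g y = (g x - g y) - (g x - g x')); last by ring.
  by apply: le_lt_trans (ler_normB _ _) _; lra.
move=> [d /= d0 hd].
exists (d / 2); first by rewrite divr_gt0.
move=> x y Kx; apply: (hd (d / 2)) => //=; last by rewrite divr_gt0.
by rewrite sub0r normrN gtr0_norm ?divr_gt0// ltr_pdivrMr// ltr_pMr// ltr1n.
Unshelve. all: by end_near. Qed.

(** Chebyshev's inequality: [k / n] is within [d] of [x] except on an event of
    probability at most $x (1 - x) / (n d^2)$, on which the error is at most
    [2 * M]. *)
Lemma bernstein_approximation (g : R -> R) (M : R) : continuous g ->
  (forall x, `|g x| <= M) -> forall e, 0 < e ->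
  exists n, forall x, 0 <= x <= 1 ->
    `|g x - bernstein n x (fun k => g (k%:R / n%:R))| <= e.
Proof.
move=> cg gM e e0.
have [d d0 hd] := unif_continuous_near_compact cg (@segment_compact R 0 1)
  (divr_gt0 e0 (ltr0n R 2)).
have M0 : 0 <= M := le_trans (normr_ge0 _) (gM 0).
(* The Chebyshev constant: beyond distance [d], [C * (x - k / n) ^+ 2] is at
   least [2 * M]. *)
pose C := 2 * M / d ^+ 2.
have C0 : 0 <= C by rewrite !divr_ge0 ?mulr_ge0 ?exprn_ge0// ltW.
pose n := (Num.truncn (2 * C / e)).+1.
have n0 : 0 < n%:R :> R by rewrite ltr0n.
have nC : C / n%:R <= e / 2.
  have : 2 * C / e < n%:R by rewrite truncnS_gt.
  rewrite ltr_pdivrMr// ler_pdivrMr// => h; nra.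
exists n => x x01.
pose B k := C * (x - k%:R / n%:R) ^+ 2 + e / 2.
have gB k : `|g x - g (k%:R / n%:R)| <= B k.
  have [h|h] := ltP `|x - k%:R / n%:R| d.
    apply: le_trans (ltW (hd _ _ _ h)) _; first by rewrite /= in_itv.
    by rewrite lerDr mulr_ge0 ?sqr_ge0.
  apply: le_trans (ler_normB _ _) _.
  apply: (@le_trans _ _ (2 * M)); first by rewrite mulrDl !mul1r lerD.
  rewrite /B; apply: (@le_trans _ _ (C * (x - k%:R / n%:R) ^+ 2)); last first.
    by rewrite lerDl divr_ge0// ltW.
  rewrite -real_normK ?num_real// /C -mulrA ler_peMr ?mulr_ge0//.
  by rewrite mulrC ler_pdivlMr ?exprn_gt0// mul1r lerXn2r// ?nnegrE ?ltW.
have -> : g x - bernstein n x (fun k => g (k%:R / n%:R)) =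
          bernstein n x (fun k => g x - g (k%:R / n%:R)).
  rewrite [X in _ = bernstein _ _ X](_ : _ = (fun k => -1 * g (k%:R / n%:R) + g x)).
    by rewrite bernstein_linear bernstein_cst; ring.
  by apply/funext => k; ring.
have BB : bernstein n x B <= e.
  rewrite (_ : B = (fun k => (C / n%:R ^+ 2) * (k%:R + - (n%:R * x)) ^+ 2 + e / 2)); last first.
    by apply/funext => k; rewrite /B; field; rewrite gt_eqF.
  rewrite bernstein_linear bernstein_cst bernstein_square subrr expr0n add0r.
  have -> : C / n%:R ^+ 2 * (n%:R * (x * (1 - x))) = C / n%:R * (x * (1 - x)).
    by field; rewrite gt_eqF.
  case/andP: x01 => x0 x1.
  have : C / n%:R * (x * (1 - x)) <= C / n%:R.
    rewrite ler_piMr ?divr_ge0//; nra.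
  by move: nC; lra.
rewrite ler_norml; apply/andP; split.
  rewrite lerNl -[X in X <= _](mulN1r) -[X in X <= _]addr0 -(bernstein_cst n x 0) -bernstein_linear.
  apply: le_trans BB; apply: le_bernstein => // k.
  by rewrite mulN1r addr0; apply: le_trans (gB k); rewrite -normrN ler_norm.
apply: le_trans BB; apply: le_bernstein => // k.
by apply: le_trans (gB k); rewrite ler_norm.
Qed.

End bernstein.

(** * The method of moments *)

(** Abstracts the law of a random variable taking finitely many values, whose
    expectation makes sense for every function, measurable or not. *)
Definition is_mean (R : realType) (L : (R -> R) -> R) : Prop :=
  [/\ forall a f g, L (fun x => a * f x + g x) = a * L f + L g,
      forall f g, (forall x, f x <= g x) -> L f <= L g
    & L (fun=> 1) = 1].

Lemma mean_dist (R : realType) (L : (R -> R) -> R) (f g B : R -> R) :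
  is_mean L -> (forall x, `|f x - g x| <= B x) -> `|L f - L g| <= L B.
Proof.
move=> [lin mono _] fgB.
rewrite ler_norml lerNl lerBlDr; apply/andP; split.
  rewrite opprB lerBlDr -[L B]mul1r -lin; apply: mono => x.
  by rewrite mul1r -lerBlDr; apply: le_trans (fgB x); rewrite distrC ler_norm.
rewrite -[L B]mul1r -lin; apply: mono => x.
by rewrite mul1r -lerBlDr; apply: le_trans (fgB x); rewrite ler_norm.
Qed.

Lemma Rintegral_probability_cst d (T : measurableType d) (R : realType)
  (P : probability T R) (a : R) : \int[P]_w a = a.
Proof.
rewrite (Rintegral_cst P measurableT a).
have -> : fine (P setT) = 1 by have /(congr1 fine) := probability_setT P.
by rewrite mulr1.
Qed.

Section moment_method.
Context d (T : measurableType d) (R : realType) (P : probability T R).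
Variables (L : nat -> (R -> R) -> R) (Y : T -> R).
Implicit Types (f g h : R -> R) (t a : R) (k K : nat).
Hypothesis meanL : forall n, is_mean (L n).
Hypothesis mY : measurable_fun setT Y.

Local Notation E h := (\int[P]_w (h (Y w))).

Definition mean_cvg (h : R -> R) : Prop :=
  [/\ measurable_fun setT h, P.-integrable setT (EFin \o (h \o Y))
    & (fun n => L n h) @ \oo --> E h].

Lemma mean_cvg_linear a f g : mean_cvg f -> mean_cvg g ->
  mean_cvg (fun x => a * f x + g x).
Proof.
move=> [mf If cf] [mg Ig cg]; split.
- by apply: measurable_funD => //; apply: measurable_funM.
- have := integrableD measurableT (integrableZl measurableT a If) Ig.
  by apply: eq_integrable.
- rewrite RintegralD//; last exact: (integrableZl measurableT a If).
  rewrite RintegralZl//.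
  under eq_fun => n do rewrite (let: And3 h _ _ := meanL n in h).
  by apply: cvgD => //; apply: cvgM => //; exact: cvg_cst.
Qed.

(** The approximation holds in mean and not uniformly: the majorant [B] may be
    an unbounded function such as a power, provided that its means converge. *)
Lemma mean_cvg_approximation h : measurable_fun setT h ->
  (forall e, 0 < e -> exists h1 B, [/\ mean_cvg h1, mean_cvg B,
     forall x, `|h x - h1 x| <= B x & E B <= e]) -> mean_cvg h.
Proof.
move=> mh approx.
have mhY f : measurable_fun setT f -> measurable_fun setT (EFin \o (f \o Y)).
  by move=> mf; apply/measurable_EFinP; exact: measurableT_comp.
have Ih : P.-integrable setT (EFin \o (h \o Y)).
  have [h1 [B [[mh1 Ih1 _] [mB IB _] hB _]]] := approx 1 ltr01.
  have I1 := integrableD measurableT (integrable_abse Ih1) IB.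
  apply: le_integrable I1 => //; first exact: mhY.
  move=> w _ /=; rewrite lee_fin; apply: le_trans (ler_norm _).
  rewrite -lerBlDl; apply: le_trans (hB (Y w)).
  exact: lerB_dist.
split => //; apply/cvgrPdist_le => e e0.
have [h1 [B [[mh1 Ih1 ch1] [mB IB cB] hB EB]]] := approx (e / 4) (divr_gt0 e0 (ltr0n R 4)).
have Eh : `|E h - E h1| <= E B.
  rewrite -RintegralB//.
  have I1 := integrableB measurableT Ih Ih1.
  apply: le_trans (le_normr_Rintegral measurableT I1) _.
  apply: le_Rintegral => //; [exact: integrable_norm I1|by move=> w _; exact: hB].
near=> n.
have Lh := mean_dist (meanL n) hB.
have c1 : `|E h1 - L n h1| <= e / 4.
  by near: n; move/cvgrPdist_le : ch1; apply; rewrite divr_gt0.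
have c2 : `|E B - L n B| <= e / 4.
  by near: n; move/cvgrPdist_le : cB; apply; rewrite divr_gt0.
move: Lh c1 c2 Eh EB; rewrite !ler_norml => /andP[? ?] /andP[? ?] /andP[? ?] /andP[? ?] ?.
by apply/andP; split; lra.
Unshelve. all: by end_near. Qed.

Lemma mean_cvg_cst a : mean_cvg (fun=> a).
Proof.
have I1 : P.-integrable setT (EFin \o ((fun=> a) \o Y)).
  exact: finite_measure_integrable_cst.
split => //.
rewrite [X in _ --> X](Rintegral_probability_cst P).
rewrite [X in X @ _](_ : _ = fun=> a); first exact: cvg_cst.
apply/funext => n; have [lin _ one] := meanL n.
have := lin (a - 1) (fun=> 1) (fun=> 1); rewrite one.
rewrite [X in L n X](_ : _ = fun=> a); last by apply/funext => x; ring.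
by move->; ring.
Qed.

Lemma eq_mean_cvg f g : f =1 g -> mean_cvg f -> mean_cvg g.
Proof. by move=> /funext ->. Qed.

Lemma mean_cvgD f g : mean_cvg f -> mean_cvg g -> mean_cvg (fun x => f x + g x).
Proof.
by move=> /mean_cvg_linear h /(h 1); apply: eq_mean_cvg => x; rewrite mul1r.
Qed.

Lemma mean_cvgZ a f : mean_cvg f -> mean_cvg (fun x => a * f x).
Proof.
move=> /(mean_cvg_linear a) h; apply: eq_mean_cvg (h _ (mean_cvg_cst 0)) => x.
by rewrite addr0.
Qed.

Lemma mean_cvgB f g : mean_cvg f -> mean_cvg g -> mean_cvg (fun x => f x - g x).
Proof.
move=> mf /(mean_cvgZ (-1)) mg.
by apply: eq_mean_cvg (mean_cvgD mf mg) => x; rewrite mulN1r.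
Qed.

Lemma mean_cvg_sum (I : Type) (r : seq I) (f : I -> R -> R) :
  (forall i, mean_cvg (f i)) -> mean_cvg (fun x => \sum_(i <- r) f i x).
Proof.
move=> mf; elim: r => [|i r IH].
  by apply: eq_mean_cvg (mean_cvg_cst 0) => x; rewrite big_nil.
by apply: eq_mean_cvg (mean_cvgD (mf i) IH) => x; rewrite big_cons.
Qed.

Hypothesis moments_cvg : forall k, mean_cvg (fun x => x ^+ k).
Hypothesis moments_growth : forall t : R,
  (fun K => t ^+ K.*2 / (K.*2)`!%:R * E (fun x => x ^+ K.*2)) @ \oo --> (0 : R).

Lemma mean_cvg_monomial k t : mean_cvg (fun x => taylor_monomial k (t * x)).
Proof.
apply: eq_mean_cvg (mean_cvgZ (t ^+ k / k`!%:R) (moments_cvg k)) => x.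
by rewrite /taylor_monomial exprMn; ring.
Qed.

(** The error of the Taylor polynomials is an even moment, which the growth
    condition makes small. *)
Lemma mean_cvg_taylor t h (S : nat -> R -> R) : measurable_fun setT h ->
  (forall K, mean_cvg (S K)) ->
  (forall K x, `|h x - S K x| <= taylor_monomial K.*2 `|t * x|) ->
  mean_cvg h.
Proof.
move=> mh mS hS; apply: mean_cvg_approximation => // e e0.
have [K _ /(_ K (leqnn K))] := (cvgrPdist_le _ _).1 (moments_growth t) e e0.
rewrite /= sub0r normrN => hK.
exists (S K), (fun x => taylor_monomial K.*2 (t * x)); split.
- exact: mS.
- exact: mean_cvg_monomial.
- move=> x; apply: le_trans (hS K x) _.
  by rewrite /taylor_monomial -normrX ger0_norm// exprn_even_ge0// odd_double.
- apply: le_trans hK; apply: le_trans (ler_norm _); rewrite le_eqVlt.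
  apply/orP; left; apply/eqP; rewrite -RintegralZl//; last first.
    by have [] := moments_cvg K.*2.
  by apply: eq_Rintegral => w _; rewrite /taylor_monomial exprMn; ring.
Qed.

Lemma mean_cvg_cos t : mean_cvg (fun x => cos (t * x)).
Proof.
apply: (@mean_cvg_taylor t _
    (fun K x => \sum_(k < K) (-1) ^+ k * taylor_monomial k.*2 (t * x))).
- apply: (measurableT_comp (f := @cos R)) => //.
  exact: continuous_measurable_fun (@continuous_cos R).
- by move=> K; apply: mean_cvg_sum => k; apply: mean_cvgZ; exact: mean_cvg_monomial.
- by move=> K x; exact: norm_cos_remainder.
Qed.

Lemma mean_cvg_sin t : mean_cvg (fun x => sin (t * x)).
Proof.
apply: (@mean_cvg_taylor t _
    (fun K x => \sum_(k < K) (-1) ^+ k * taylor_monomial k.*2.+1 (t * x))).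
- apply: (measurableT_comp (f := @sin R)) => //.
  exact: continuous_measurable_fun (@continuous_sin R).
- by move=> K; apply: mean_cvg_sum => k; apply: mean_cvgZ; exact: mean_cvg_monomial.
- by move=> K x; exact: norm_sin_remainder.
Qed.

Let modulable h := forall t, mean_cvg (fun x => h x * cos (t * x)) /\
                             mean_cvg (fun x => h x * sin (t * x)).

(** Multiplying by a sine only shifts frequencies, by the product-to-sum
    formulas. Carrying all frequencies [t] along makes the class stable under
    products, hence under polynomials in a sine. *)
Let modulable_sin s h : modulable h -> modulable (fun x => sin (s * x) * h x).
Proof.
move=> mh t; have [cp sp] := mh (s + t); have [cm sm] := mh (s - t); split.
  apply: eq_mean_cvg (mean_cvgD (mean_cvgZ 2^-1 sp) (mean_cvgZ 2^-1 sm)) => x.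
  by rewrite /= [(s + t) * x]mulrDl [(s - t) * x]mulrBl sinD sinB; field.
apply: eq_mean_cvg (mean_cvgB (mean_cvgZ 2^-1 cm) (mean_cvgZ 2^-1 cp)) => x.
by rewrite /= [(s + t) * x]mulrDl [(s - t) * x]mulrBl cosB cosD; field.
Qed.

Let modulable_bernstein s n (g : nat -> R) :
  modulable (fun x => bernstein n ((1 + sin (s * x)) / 2) g).
Proof.
elim: n g => [|n IH] g t /=.
  by split; apply: mean_cvgZ; [exact: mean_cvg_cos|exact: mean_cvg_sin].
have [c1 s1] := IH (g \o S) t; have [c2 s2] := IH g t.
have [c3 s3] := modulable_sin s (IH (g \o S)) t.
have [c4 s4] := modulable_sin s (IH g) t.
split.
  apply: eq_mean_cvg (mean_cvgD
    (mean_cvgD (mean_cvgZ 2^-1 c1) (mean_cvgZ 2^-1 c3))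
    (mean_cvgB (mean_cvgZ 2^-1 c2) (mean_cvgZ 2^-1 c4))) => x; by rewrite /=; field.
apply: eq_mean_cvg (mean_cvgD
  (mean_cvgD (mean_cvgZ 2^-1 s1) (mean_cvgZ 2^-1 s3))
  (mean_cvgB (mean_cvgZ 2^-1 s2) (mean_cvgZ 2^-1 s4))) => x; by rewrite /=; field.
Qed.

(** On [-A, A] a continuous function of [x] is a continuous function of
    [sin (x / A)], hence uniformly close to a Bernstein polynomial in
    [(1 + sin (x / A)) / 2], whose means converge. Outside, the error is
    bounded and therefore dominated by a small multiple of [x ^+ 2] when [A] is
    large. *)
Theorem method_of_moments f : continuous f -> (exists M : R, forall x, `|f x| <= M) ->
  mean_cvg f.
Proof.
move=> cf [M fM].
have M0 : 0 <= M := le_trans (normr_ge0 _) (fM 0).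
apply: mean_cvg_approximation; first exact: continuous_measurable_fun.
move=> e e0.
pose m2 := E (fun x => x ^+ 2).
have m20 : 0 <= m2 by apply: Rintegral_ge0 => w _; rewrite sqr_ge0.
(* Large enough for [(2 * M + 1) / A] times the second moment of the limit to
   be at most [e / 2]. *)
pose A : R := 1 + (2 * M + 1) * m2 * 2 / e.
have A1 : 1 <= A by rewrite /A lerDl divr_ge0 ?mulr_ge0 ?addr_ge0 ?mulr_ge0// ltW.
have A0 : 0 < A by apply: lt_le_trans A1.
pose s : R := A^-1.
have s0 : 0 < s by rewrite invr_gt0.
pose b : R := sin 1.
have pi1 : 1 <= pi / 2 :> R by exact: pihalf_ge1.
have b1 : b < 1.
  rewrite lt_neqAle sin_le1 andbT; apply/negP => /eqP b1.
  have : cos 1 = 0 :> R.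
    by apply/eqP; rewrite -norm_sin_eq1 -/b b1 normr1.
  by move/eqP; rewrite gt_eqF// cos1_gt0.
have b0 : 0 <= b.
  by apply: ltW; apply: sin2_gt0; rewrite ltr01 ltr1n.
(* The arcsine is continuous on the open interval; clamping at [sin 1] keeps
   its argument there and changes nothing for [`|x| <= A], where
   [`|s * x| <= 1]. *)
pose clamp (u : R) : R := Num.max (- b) (Num.min b u).
have clamp_bnd (u : R) : -1 < clamp u < 1.
  rewrite /clamp lt_max gt_max ltrN2 b1/= gt_min b1 andbT/=.
  by lra.
pose g (v : R) : R := f (A * asin (clamp (2 * v - 1))).
have cg : continuous g.
  have ccl : continuous (fun v : R => clamp (2 * v - 1)).
    move=> v.
    have c1 : {for v, continuous (fun v : R => 2 * v - 1)}.
      apply: continuousB; last exact: cst_continuous.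
      by apply: continuousM; [exact: cst_continuous|exact: cvg_id].
    have c2 (a : R) : {for v, continuous (fun _ : R => a)} by exact: cst_continuous.
    exact: (continuous_max (c2 (- b)) (continuous_min (c2 b) c1)).
  move=> v.
  have cas : {for v, continuous (fun v : R => A * asin (clamp (2 * v - 1)))}.
    apply: continuousM; first exact: cst_continuous.
    apply: (continuous_comp (ccl v)).
    exact: continuous_asin.
  exact: (continuous_comp cas (cf _)).
have gM v : `|g v| <= M by exact: fM.
have gE (x : R) : `|x| <= A -> g ((1 + sin (s * x)) / 2) = f x.
  move=> xA; rewrite /g; congr f.
  have -> : 2 * ((1 + sin (s * x)) / 2) - 1 = sin (s * x) by field.
  have sx : `|s * x| <= 1.
    by rewrite normrM gtr0_norm// mulrC ler_pdivrMr// mul1r.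
  have itv (y : R) : `|y| <= 1 -> y \in `[(- (pi / 2)), (pi / 2)].
    rewrite ler_norml in_itv/= => /andP[y1 y2].
    by apply/andP; split; lra.
  have sinmono (y z : R) : `|y| <= 1 -> `|z| <= 1 -> y <= z -> sin y <= sin z.
    move=> /itv y1 /itv z1; rewrite le_eqVlt => /predU1P[->//|yz].
    by apply: ltW; rewrite ltr_sin.
  have -> : clamp (sin (s * x)) = sin (s * x).
    move: (sx); rewrite ler_norml => /andP[sx1 sx2].
    rewrite /clamp min_r ?max_r//; last by rewrite sinmono// normr1.
    by rewrite /b -sinN sinmono// normrN normr1.
  by rewrite sinK ?itv// /s mulrA divff ?mul1r// gt_eqF.
have [n hn] := bernstein_approximation cg gM (divr_gt0 e0 (ltr0n R 2)).
exists (fun x => bernstein n ((1 + sin (s * x)) / 2) (fun k => g (k%:R / n%:R))).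
(* For [`|x| > A] the first term is at least [2 * M + 1], more than the
   error. *)
exists (fun x => (2 * M + 1) / A * (x ^+ 2) + e / 2).
split.
- have [h _] := modulable_bernstein s n (fun k => g (k%:R / n%:R)) 0.
  by apply: eq_mean_cvg h => x; rewrite mul0r cos0 mulr1.
- apply: mean_cvgD; last exact: mean_cvg_cst.
  by apply: mean_cvgZ; exact: moments_cvg.
- move=> x; set u := (1 + _) / 2.
  have u01 : 0 <= u <= 1.
    have := sin_geN1 (s * x); have := sin_le1 (s * x) => *.
    by rewrite /u; apply/andP; split; lra.
  have hnu := hn u u01.
  rewrite (_ : f x - _ = (f x - g u) + (g u - bernstein n u (fun k => g (k%:R / n%:R)))); last by ring.
  apply: le_trans (ler_normD _ _) _; apply: lerD => //.
  have C0 : 0 <= (2 * M + 1) / A by apply: divr_ge0; [lra|exact: ltW].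
  have [xA|xA] := leP `|x| A.
    by rewrite gE// subrr normr0 mulr_ge0// sqr_ge0.
  apply: le_trans (ler_normB _ _) _.
  have := gM u; have := fM x.
  suff : 2 * M + 1 <= (2 * M + 1) / A * x ^+ 2 by lra.
  rewrite mulrAC ler_pdivlMr// ler_wpM2l//; first by lra.
  rewrite -real_normK ?num_real//; apply: le_trans (ltW xA) _.
  by rewrite expr2 ler_peMl// ltW// (le_lt_trans A1).
- have [_ I2 _] := moments_cvg 2.
  rewrite RintegralD//; last 2 first.
    have := integrableZl measurableT ((2 * M + 1) / A) I2.
    by apply: eq_integrable.
    by have [_ h _] := mean_cvg_cst (e / 2).
  rewrite RintegralZl// Rintegral_probability_cst -/m2.
  suff : (2 * M + 1) / A * m2 <= e / 2 by lra.
  rewrite mulrAC ler_pdivrMr//.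
  have : (2 * M + 1) * m2 * 2 / e <= A by rewrite /A lerDr.
  by rewrite ler_pdivrMr// => h; lra.
Qed.

End moment_method.

(** * Moments and moment generating functions *)

Section taylor_uniqueness.
Variable R : realType.

(** At the first index [k] where the expansions differ, dividing their
    difference by [t ^+ k] and letting [t] decrease to [0] gives a
    contradiction. Working with one-sided expansions accommodates functions
    known only near [0] on the positive side. *)
Lemma taylor_coefficients_unique (m : R -> R) (a c : nat -> R) (rho : R) :
  0 < rho ->
  (forall J, exists C, forall t, 0 < t <= rho ->
     `|m t - \sum_(k < J.*2) a k * t ^+ k| <= C * t ^+ J.*2) ->
  (forall J, exists C, forall t, 0 < t <= rho ->
     `|m t - \sum_(k < J.*2) c k * t ^+ k| <= C * t ^+ J.*2) ->
  a =1 c.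
Proof.
move=> rho0 ma mc k; elim/ltn_ind: k => k IH.
have [C1 h1] := ma k.+1; have [C2 h2] := mc k.+1.
apply/eqP; rewrite -subr_eq0 -normr_eq0; apply/eqP.
pose d i := a i - c i; rewrite -/(d k).
pose C := C1 + C2 + \sum_(i < k.+1.*2) `|d i|.
have kJ : (k < k.+1.*2)%N by rewrite doubleS ltnS -addnn -addnS leq_addr.
have small t : 0 < t -> t <= rho -> t <= 1 -> `|d k| <= C * t.
  move=> t0 trho t1.
  have tr : 0 < t <= rho by rewrite t0.
  have : `|\sum_(i < k.+1.*2) d i * t ^+ i| <= (C1 + C2) * t ^+ k.+1.
    rewrite (_ : \sum_(i < _) _ = (m t - \sum_(i < k.+1.*2) c i * t ^+ i) -
                       (m t - \sum_(i < k.+1.*2) a i * t ^+ i)); last first.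
      rewrite opprB addrC addrA subrK -sumrB.
      by apply: eq_bigr => i _; rewrite /d mulrBl.
    apply: le_trans (ler_normB _ _) _.
    have le12 : t ^+ k.+1.*2 <= t ^+ k.+1.
      by rewrite ler_wiXn2l// ?ltW// -addnn leq_addr.
    have C10 : 0 <= C1.
      by rewrite -(pmulr_lge0 _ (exprn_gt0 k.+1.*2 t0)) (le_trans _ (h1 t tr)).
    have C20 : 0 <= C2.
      by rewrite -(pmulr_lge0 _ (exprn_gt0 k.+1.*2 t0)) (le_trans _ (h2 t tr)).
    rewrite addrC mulrDl; apply: lerD.
      by apply: le_trans (h1 t tr) _; rewrite ler_wpM2l.
    by apply: le_trans (h2 t tr) _; rewrite ler_wpM2l.
  pose ik := Ordinal kJ.
  rewrite (bigD1 ik)//= => hsum.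
  have rest : `|\sum_(i < k.+1.*2 | i != ik) d i * t ^+ i| <=
              (\sum_(i < k.+1.*2) `|d i|) * t ^+ k.+1.
    apply: le_trans (ler_norm_sum _ _ _) _.
    rewrite mulr_suml [leRHS](bigID (fun i => i != ik))/= ler_wpDr//.
      by apply: sumr_ge0 => i _; rewrite mulr_ge0// exprn_ge0// ltW.
    apply: ler_sum => i ik'; rewrite normrM.
    have [ilek|klti] := ltnP i k.
      by rewrite /d IH// subrr normr0 !mul0r.
    have {}klti : (k < i)%N.
      rewrite ltn_neqAle klti andbT; apply: contra ik' => /eqP ki.
      by apply/eqP/val_inj.
    rewrite ler_wpM2l// (ger0_norm (exprn_ge0 i (ltW t0))).
    by rewrite ler_wiXn2l// ltW.
  have : `|d k * t ^+ k| <= C * t ^+ k.+1.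
    rewrite /C [leRHS]mulrDl -[X in `|X|](addrK (\sum_(i < k.+1.*2 | i != ik) d i * t ^+ i)).
    apply: le_trans (ler_normB _ _) _; exact: lerD hsum rest.
  rewrite normrM (ger0_norm (exprn_ge0 _ (ltW t0))) exprS mulrA.
  by rewrite ler_pM2r// exprn_gt0.
have C0 : 0 <= C.
  have t0 : 0 < Num.min rho 1 by rewrite lt_min rho0 ltr01.
  have h : `|d k| <= C * Num.min rho 1 by apply: small; rewrite // ge_min lexx ?orbT.
  by rewrite -(pmulr_lge0 _ t0) (le_trans _ h).
apply/eqP; rewrite eq_le normr_ge0 andbT.
apply/ler_addgt0Pl => e e0; rewrite addr0.
pose t := Num.min (Num.min rho 1) (e / (C + 1)).
have eC : 0 < e / (C + 1) by rewrite divr_gt0// ltr_wpDl.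
have t0 : 0 < t by rewrite !lt_min rho0 ltr01.
apply: le_trans (small t t0 _ _) _.
- by rewrite /t !ge_min lexx.
- by rewrite /t !ge_min lexx orbT.
apply: (@le_trans _ _ (C * (e / (C + 1)))).
  by rewrite ler_wpM2l// /t ge_min lexx orbT.
by rewrite mulrA ler_pdivrMr ?ltr_wpDl//; lra.
Qed.

End taylor_uniqueness.

Section exponential_estimates.
Variable R : realType.
Implicit Types (x y : R) (k K : nat).

Lemma le_expR_monomial k x : 0 <= x -> x ^+ k / k`!%:R <= expR x.
Proof.
case: k => [|k] x0; first by rewrite expr0 divr1 -expR0 ler_expR.
by apply: le_trans (expR_ge1Dxn k x0); rewrite lerDr.
Qed.

Lemma expR_remainder K x :
  `|expR x - \sum_(k < K) x ^+ k / k`!%:R| <= `|x| ^+ K * expR `|x|.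
Proof.
pose F K (x : R) := expR x - \sum_(k < K) x ^+ k / k`!%:R.
have dF n y : is_derive y 1 (F n.+1) (F n y).
  elim: n y => [|n IH] y.
    have -> : F 1%N = expR - cst (1 : R).
      by apply/funext => z; rewrite /F big_ord1 expr0 divr1 !fctE.
    rewrite /F big_ord0.
    have h := is_derive_expR y; apply: is_deriveB.
  have -> : F n.+2 = F n.+1 - taylor_monomial n.+1.
    by apply/funext => z; rewrite /F big_ord_recr/= !fctE opprD addrA.
  have := is_deriveB (IH y) (is_derive_taylor_monomial n y).
  by congr is_derive; rewrite /F big_ord_recr/= opprD addrA.
rewrite -/(F K x); elim: K x => [|K IH] x.
  rewrite expr0 mul1r /F big_ord0 subr0 gtr0_norm ?expR_gt0// ler_expR.
  exact: ler_norm.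
have F0 : F K.+1 0 = 0.
  rewrite /F expR0 big_ord_recl big1 ?addr0 => [|i _].
    by rewrite expr0 divr1 subrr.
  by rewrite expr0n mul0r.
have cF (a b : R) : {within `[a, b], continuous (F K.+1)}.
  by apply: derivable_within_continuous => y _; apply: (@ex_derive _ _ _ _ _ _ _ (dF K y)).
have [c cx eq] : exists2 c, `|c| <= `|x| & F K.+1 x = F K c * x.
  have [x0|x0] := leP 0 x.
    have [c] := MVT_segment x0 (fun y _ => dF K y) (cF 0 x).
    rewrite in_itv/= F0 !subr0 => /andP[c0 cx] e; exists c => //.
    by rewrite !ger0_norm.
  have [c] := MVT_segment (ltW x0) (fun y _ => dF K y) (cF x 0).
  rewrite in_itv/= F0 !sub0r => /andP[c0 cx] e; exists c => //.
    by rewrite !ler0_norm ?lerN2// ltW.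
  by apply/oppr_inj; rewrite e mulrN.
rewrite eq normrM exprSr mulrAC ler_wpM2r//.
apply: le_trans (IH c) _; apply: ler_pM => //.
- by rewrite lerXn2r// nnegrE.
- by rewrite ler_expR.
Qed.

End exponential_estimates.

Lemma Rintegral_sum d (T : measurableType d) (R : realType)
    (mu : {measure set T -> \bar R}) (f : nat -> T -> R) n :
  (forall k, mu.-integrable setT (EFin \o f k)) ->
  mu.-integrable setT (EFin \o (fun w => \sum_(k < n) f k w)) /\
  \int[mu]_w (\sum_(k < n) f k w) = \sum_(k < n) \int[mu]_w f k w.
Proof.
move=> If; elim: n => [|n [IS SE]].
  have e : (fun w => \sum_(k < 0) f k w) = fun=> 0.
    by apply/funext => w; rewrite big_ord0.
  rewrite e big_ord0; split; first exact: integrable0.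
  by rewrite Rintegral_cst// mul0r.
have e : (fun w => \sum_(k < n.+1) f k w) = fun w => \sum_(k < n) f k w + f n w.
  by apply/funext => w; rewrite big_ord_recr.
rewrite e big_ord_recr/= -SE; split; last by rewrite RintegralD.
by apply: eq_integrable (integrableD measurableT IS (If n)).
Qed.

Section moments_from_mgf.
Context d (T : measurableType d) (R : realType) (P : probability T R).
Variables (Y : {RV P >-> R}) (m : R -> R).
Hypothesis mgfE : forall t, 'M_P Y t = (m t)%:E.

Let mY : measurable_fun setT Y.
Proof. exact: measurable_funP. Qed.

Let measurable_expRM t : measurable_fun setT (fun w => expR (t * Y w)).
Proof.
apply: (measurableT_comp (f := @expR R)) => //.
by apply: measurable_funM => //; exact: mY.
Qed.

Let measurable_expRM_norm t : measurable_fun setT (fun w => expR (t * `|Y w|)).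
Proof.
apply: (measurableT_comp (f := @expR R)) => //.
by apply: measurable_funM => //; apply: measurableT_comp.
Qed.

Lemma mgf_integrable t : P.-integrable setT (EFin \o (fun w => expR (t * Y w))).
Proof.
apply/integrableP; split; first exact/measurable_EFinP.
have := mgfE t; rewrite /mmt_gen_fun unlock.
under eq_integral => w _ do rewrite /= mulrC.
move=> e; under eq_integral => w _ do rewrite /= ger0_norm ?expR_ge0//.
by rewrite e ltry.
Qed.

Lemma mgf_Rintegral t : \int[P]_w expR (t * Y w) = m t.
Proof.
have := mgfE t; rewrite /mmt_gen_fun unlock.
under eq_integral => w _ do rewrite /= mulrC.
by rewrite /Rintegral => ->.
Qed.

(** [expR (t * `|y|)] is at most [expR (t * y) + expR (- t * y)]. *)
Lemma integrable_expR_norm t : 0 <= t ->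
  P.-integrable setT (EFin \o (fun w => expR (t * `|Y w|))).
Proof.
move=> t0.
have := integrableD measurableT (mgf_integrable t) (mgf_integrable (- t)).
apply: le_integrable => //; first exact/measurable_EFinP.
move=> w _ /=; rewrite lee_fin ger0_norm ?expR_ge0//.
apply: le_trans (ler_norm _).
have [y0|y0] := leP 0 (Y w); first by rewrite (ger0_norm y0) lerDl expR_ge0.
by rewrite (ltr0_norm y0) mulrN mulNr lerDr expR_ge0.
Qed.

Let measurable_moment k : measurable_fun setT (fun w => Y w ^+ k).
Proof. exact: measurable_funX. Qed.

Lemma moment_integrable k : P.-integrable setT (EFin \o (fun w => Y w ^+ k)).
Proof.
have := integrableZl measurableT k`!%:R (integrable_expR_norm ler01).
apply: le_integrable => //; first exact/measurable_EFinP.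
move=> w _ /=; rewrite lee_fin mul1r normrX; apply: le_trans (ler_norm _).
have := le_expR_monomial k (normr_ge0 (Y w)).
by rewrite ler_pdivrMr ?ltr0n ?fact_gt0// mulrC.
Qed.

(** The Taylor remainder of the exponential at [t * Y] is at most [`|t| ^+ K]
    times a multiple of [expR (2 * `|Y|)], which is integrable. *)
Lemma mgf_taylor K : exists C, forall t, `|t| <= 1 ->
  `|m t - \sum_(k < K) (\int[P]_w (Y w ^+ k)) / k`!%:R * t ^+ k|
    <= C * `|t| ^+ K.
Proof.
have I2 := integrable_expR_norm (ler0n R 2).
exists (K`!%:R * \int[P]_w expR (2 * `|Y w|)) => t t1.
have Is k : P.-integrable setT (EFin \o (fun w => (t ^+ k / k`!%:R) * Y w ^+ k)).
  by apply: eq_integrable (integrableZl measurableT (t ^+ k / k`!%:R) (moment_integrable k)).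
have [IS SE] := Rintegral_sum K Is.
have -> : \sum_(k < K) (\int[P]_w (Y w ^+ k)) / k`!%:R * t ^+ k =
          \int[P]_w (\sum_(k < K) (t ^+ k / k`!%:R) * Y w ^+ k).
  rewrite SE; apply: eq_bigr => k _.
  rewrite RintegralZl//; last exact: moment_integrable.
  by ring.
rewrite -mgf_Rintegral -RintegralB//; last exact: mgf_integrable.
have ID := integrableB measurableT (mgf_integrable t) IS.
apply: le_trans (le_normr_Rintegral measurableT ID) _.
rewrite mulrC mulrA -RintegralZl//.
apply: le_Rintegral => //; first exact: integrable_norm ID.
  by apply: eq_integrable (integrableZl measurableT (`|t| ^+ K * K`!%:R) I2).
move=> w _; rewrite [X in _ - X](_ : _ = \sum_(k < K) (t * Y w) ^+ k / k`!%:R); last first.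
  by apply: eq_bigr => k _; rewrite exprMn; ring.
apply: le_trans (expR_remainder K (t * Y w)) _.
rewrite normrM exprMn -!mulrA ler_wpM2l ?exprn_ge0//.
have := le_expR_monomial K (normr_ge0 (Y w)).
rewrite ler_pdivrMr ?ltr0n ?fact_gt0// => h.
rewrite (_ : 2 = 1 + 1 :> R) 1?mulr2n// mulrDl mul1r expRD mulrCA mulrA; apply: ler_pM => //.
by rewrite ler_expR ler_piMl.
Qed.

(** Each term of the exponential series of [b * `|Y|] is below its sum. *)
Lemma moment_exponential_bound (b : R) : 0 <= b -> exists C, forall k,
  b ^+ k * `|\int[P]_w (Y w ^+ k)| / k`!%:R <= C.
Proof.
move=> b0; exists (\int[P]_w expR (b * `|Y w|)) => k.
have Ik := moment_integrable k.
have IN : P.-integrable setT (EFin \o (fun w => (b ^+ k / k`!%:R) * `|Y w ^+ k|)).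
  by apply: eq_integrable (integrableZl measurableT (b ^+ k / k`!%:R) (integrable_norm Ik)).
apply: (@le_trans _ _ ((b ^+ k / k`!%:R) * \int[P]_w `|Y w ^+ k|)).
  rewrite mulrAC ler_wpM2l ?divr_ge0 ?exprn_ge0//.
  exact: le_normr_Rintegral.
rewrite -RintegralZl//; last exact: integrable_norm.
apply: le_Rintegral => //; first exact: integrable_expR_norm.
move=> w _; rewrite normrX mulrAC -exprMn.
by apply: le_expR_monomial; rewrite mulr_ge0.
Qed.

End moments_from_mgf.

(** * Gaussian moments *)

Section integral_has_law.
Context (R : realType) d (T : measurableType d) (P : probability T R).
Variable f : {RV P >-> R}.
Let g : T -> measurableTypeR R := f.
Let mg : measurable_fun setT g.
Proof. have h : measurable_fun setT (f : T -> R) by []. exact h. Qed.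
HB.instance Definition _ := isMeasurableFun.Build _ _ _ _ g mg.

(** The law of [f] and [nu] live on two displays of the Borel sets of [R];
    viewing [f] as a map into the second one identifies them. *)
Lemma ge0_integral_has_law (nu : {measure set (measurableTypeR R) -> \bar R})
    (h : measurableTypeR R -> \bar R) : has_law f nu ->
  measurable_fun setT h -> (forall x, 0 <= h x)%E ->
  (\int[P]_w h (f w) = \int[nu]_x h x)%E.
Proof.
move=> fnu mh h0.
rewrite -(ge0_integral_distribution (g : {RV P >-> measurableTypeR R}) mh h0).
by apply: eq_measure_integral => A mA _; exact: fnu.
Qed.

End integral_has_law.

Section gaussian_moments.
Context (R : realType).
Local Notation mu := (@lebesgue_measure R).

Lemma ge0_integral_normal_prob (a s : R) (f : R -> \bar R) :
  measurable_fun setT f -> (forall x, 0 <= f x)%E ->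
  (\int[normal_prob a s]_x f x = \int[mu]_x (f x * (normal_pdf a s x)%:E))%E.
Proof.
move=> mf f0.
have dom := normal_prob_dominates a s.
rewrite -(Radon_Nikodym_SigmaFinite.change_of_variables dom f0 measurableT mf).
have If := Radon_Nikodym_SigmaFinite.f_integrable dom.
apply: ae_eq_integral => //.
- apply: emeasurable_funM => //; exact: measurable_int If.
- apply: emeasurable_funM => //; apply/measurable_EFinP.
  exact: measurable_normal_pdf.
- apply: ae_eqe_mul2l; apply: integral_ae_eq => //.
  + by apply/measurable_EFinP; exact: measurable_normal_pdf.
  + by move=> E _ mE; rewrite -Radon_Nikodym_SigmaFinite.f_integral.
Qed.

Context d (T : measurableType d) (P : probability T R).
Variables (N : {RV P >-> R}) (s : R).
Hypothesis s0 : s != 0.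
Hypothesis lawN : has_law N (normal_prob 0 s).

(** Completing the square turns the integrand into a normal density of mean
    [t * s ^+ 2]. *)
Lemma normal_mgf t : 'M_P N t = (expR (t ^+ 2 * s ^+ 2 / 2))%:E.
Proof.
rewrite /mmt_gen_fun unlock.
have mexp : measurable_fun setT (fun x : R => (expR (t * x))%:E).
  by apply/measurable_EFinP; apply: (measurableT_comp (f := @expR R)).
transitivity (\int[P]_w (expR (t * N w))%:E)%E.
  by apply: eq_integral => w _ /=; rewrite mulrC.
have e0 x : (0 <= (expR (t * x))%:E)%E by rewrite lee_fin expR_ge0.
rewrite (ge0_integral_has_law lawN (h := fun x => (expR (t * x))%:E) mexp e0).
rewrite ge0_integral_normal_prob//.
transitivity (\int[mu]_x ((expR (t ^+ 2 * s ^+ 2 / 2))%:E * (normal_pdf (t * s ^+ 2) s x)%:E))%E.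
  apply: eq_integral => x _; rewrite -!EFinM; congr EFin.
  rewrite !normal_pdfE// /normal_fun/= mulrCA [RHS]mulrCA.
  congr (_ * _); rewrite -!expRD; congr expR.
  by rewrite -mulr_natr; field.
rewrite integralZl//; last exact: integrable_normal_pdf.
by rewrite integral_normal_pdf mule1.
Qed.

Definition gaussian_moment (v : R) k : R :=
  if odd k then 0 else k`!%:R * (v / 2) ^+ k./2 / (k./2)`!%:R.

(** The expansion of [expR (t ^+ 2 * s ^+ 2 / 2)] has only even terms; its
    coefficients are the moments divided by factorials. *)
Lemma normal_moment k : \int[P]_w (N w ^+ k) = gaussian_moment (s ^+ 2) k.
Proof.
pose c i : R := if odd i then 0 else (s ^+ 2 / 2) ^+ i./2 / (i./2)`!%:R.
suff e : (\int[P]_w (N w ^+ k)) / k`!%:R = c k.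
  have k0 : k`!%:R != 0 :> R by rewrite pnatr_eq0 -lt0n fact_gt0.
  rewrite -[LHS](divfK k0) e /c /gaussian_moment; case: ifP => _.
    by rewrite mul0r.
  by rewrite -mulrA mulrC.
apply: (@taylor_coefficients_unique R (fun t => expR (t ^+ 2 * s ^+ 2 / 2))
  (fun i => (\int[P]_w (N w ^+ i)) / i`!%:R) c 1 ltr01) => J.
  have [C hC] := mgf_taylor normal_mgf J.*2.
  exists C => t /andP[t0 t1]; have := hC t; rewrite (gtr0_norm t0); exact.
exists ((s ^+ 2 / 2) ^+ J * expR (s ^+ 2 / 2)) => t /andP[t0 t1].
have -> : \sum_(i < J.*2) c i * t ^+ i = \sum_(j < J) (t ^+ 2 * s ^+ 2 / 2) ^+ j / j`!%:R.
  elim: J => [|J IH]; first by rewrite !big_ord0.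
  rewrite doubleS !big_ord_recr/= IH /c/= odd_double/= doubleK mul0r addr0.
  congr (_ + _); rewrite -[J.*2]mul2n exprM.
  rewrite [(t ^+ 2 * s ^+ 2 / 2) ^+ J](_ : _ = (s ^+ 2 / 2) ^+ J * (t ^+ 2) ^+ J); last first.
    by rewrite -[RHS]exprMn; congr (_ ^+ _); ring.
  by ring.
apply: le_trans (expR_remainder _ _) _.
have v0 : 0 <= s ^+ 2 / 2 by rewrite divr_ge0 ?sqr_ge0.
have -> : t ^+ 2 * s ^+ 2 / 2 = t ^+ 2 * (s ^+ 2 / 2) by ring.
set v := s ^+ 2 / 2 in v0 *.
rewrite (ger0_norm (mulr_ge0 (sqr_ge0 t) v0)) [(_ * v) ^+ _]exprMn -exprM mul2n.
rewrite [leRHS]mulrC -mulrA ler_wpM2l ?exprn_ge0 ?(ltW t0)//.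
rewrite ler_wpM2l ?exprn_ge0// ler_expR ler_piMl//.
by rewrite expr_le1 // ltW.
Qed.

(** This recursion is how the Gaussian moments are recognised in the limit of
    the walk. *)
Lemma gaussian_momentSS v k :
  gaussian_moment v k.+2 = k.+1%:R * v * gaussian_moment v k.
Proof.
rewrite /gaussian_moment /= negbK; case: ifPn => kodd; first by rewrite mulr0.
rewrite !factS !natrM exprS.
have kE : k = (k./2).*2 by rewrite -[LHS]odd_double_half (negbTE kodd).
have -> : k.+2%:R = 2 * (k./2).+1%:R :> R.
  by rewrite [in LHS]kE -doubleS -mul2n natrM.
by field; rewrite -[1 + _]/(1%:R + _) -natrD !pnatr_eq0 -lt0n fact_gt0.
Qed.

End gaussian_moments.

(** * The Gamma function *)

Section euler_integral.
Variable R : realType.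
Implicit Types (x y t : R) (n : nat).
Local Notation mu := (@lebesgue_measure R).
Local Notation pos := (`]0, +oo[%classic : set R).

Let measurable_pos : measurable (pos : set (measurableTypeR R)).
Proof. exact: measurable_itv. Qed.

(** For a nonnegative integrand the limit of the primitive is the Lebesgue
    integral, so that its finiteness already is integrability. *)
Lemma integral_pos_FTC (f F : R -> R) (l : R) :
  (forall t, 0 <= t -> 0 <= f t) ->
  (forall t, 0 < t -> {for t, continuous f}) ->
  f t @[t --> 0^'+] --> f 0 ->
  (forall t, 0 < t -> is_derive t 1 F (f t)) ->
  F t @[t --> 0^'+] --> F 0 -> F t @[t --> +oo%R] --> l ->
  mu.-integrable pos (EFin \o f) /\ \int[mu]_(t in pos) f t = l - F 0.
Proof.
move=> f0 cf cf0 dF cF0 cFl.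
have mf : measurable_fun pos f.
  apply: open_continuous_measurable_fun => //.
  by move=> t; rewrite inE/= in_itv/= andbT => /cf.
have I : (\int[mu]_(t in pos) (f t)%:E = (l - F 0)%:E)%E.
  rewrite integral_itv_obnd_cbnd; last exact/measurable_EFinP.
  rewrite EFinB; apply: ge0_continuous_FTC2y => //.
  - apply/continuous_within_itvcyP; split => // t.
    by rewrite in_itv/= andbT => /cf.
  - by move=> t t0; have h := dF t t0; apply: (@ex_derive _ _ _ _ _ _ _ h).
  - move=> t; rewrite in_itv/= andbT => t0; have h := dF t t0.
    by rewrite derive1E (@derive_val _ _ _ _ _ _ _ h).
split; last by rewrite /Rintegral I.
apply/integrableP; split; first exact/measurable_EFinP.
have -> : (\int[mu]_(t in pos) `|(EFin \o f) t| = \int[mu]_(t in pos) (f t)%:E)%E.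
  apply: eq_integral => t; rewrite inE/= in_itv/= andbT => t0.
  by rewrite /= ger0_norm ?f0// ltW.
by rewrite I ltry.
Qed.

Let cvg_expR_scale (c : R) : 0 < c -> expR (- (c * t)) @[t --> +oo%R] --> (0 : R).
Proof.
move=> c0.
apply: (@cvg_comp _ _ _ (fun t : R => c * t) (fun u => expR (- u)) _ (pinfty_nbhs R)); last exact: cvgr_expR.
by apply: gt0_cvgMry.
Qed.

Let is_derive_expR_scale (c : R) t : c != 0 ->
  is_derive t 1 (fun t => - c^-1 * expR (- (c * t))) (expR (- (c * t))).
Proof.
move=> c0.
have h1 : is_derive t 1 (fun t : R => - (c * t)) (- c).
  have -> : (fun t : R => - (c * t)) = (- c : R) *: (@id R).
    by apply/funext => u; rewrite !fctE /GRing.scale/= mulNr.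
  by apply: is_derive_eq; rewrite [LHS]mulr1.
have h2 : is_derive t 1 (expR \o (fun t : R => - (c * t))) (expR (- (c * t)) * - c).
  by apply: is_derive1_comp.
have := is_deriveZ (- c^-1) h2; rewrite [X in is_derive _ _ _ X](_ : _ = expR (- (c * t))) //.
by rewrite /GRing.scale/=; field.
Qed.

Let continuous_expR_scale (c : R) : continuous (fun t : R => expR (- (c * t))).
Proof.
move=> t; apply: continuous_comp; last exact: continuous_expR.
apply: continuousN; apply: continuousM; [exact: cst_continuous|exact: cvg_id].
Qed.

Let integral_expR_scale (c : R) : 0 < c ->
  mu.-integrable pos (EFin \o (fun t => expR (- (c * t)))) /\
  \int[mu]_(t in pos) expR (- (c * t)) = c^-1.
Proof.
move=> c0.
have c2 : continuous (fun t : R => - c^-1 * expR (- (c * t))).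
  move=> t; apply: (@continuousM _ _ (fun=> - c^-1) (fun t : R => expR (- (c * t))) t).
    exact: cst_continuous.
  exact: continuous_expR_scale.
have [] := @integral_pos_FTC (fun t => expR (- (c * t))) (fun t => - c^-1 * expR (- (c * t))) 0.
- by move=> t _; exact: expR_ge0.
- by move=> t _; exact: continuous_expR_scale.
- by apply/cvg_at_right_filter; exact: continuous_expR_scale.
- by move=> t _; apply: is_derive_expR_scale; rewrite gt_eqF.
- by apply/cvg_at_right_filter; exact: c2.
- rewrite -[0](mulr0 (- c^-1)); apply: cvgM; first exact: cvg_cst.
  exact: cvg_expR_scale.
by move=> h ->; split => //; rewrite mulr0 oppr0 expR0 mulr1 sub0r opprK.
Qed.

Let half_gt0 : 0 < 2^-1 :> R. Proof. by rewrite invr_gt0. Qed.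

(** Half of the exponential decay absorbs the power; the other half is an
    integrable majorant for all the Gamma integrals. *)
Lemma powR_expR_bound x : 0 <= x -> exists2 C, 0 <= C &
  forall t, 0 <= t -> t `^ x * expR (- t) <= C * expR (- (2^-1 * t)).
Proof.
move=> x0; pose n := (Num.truncn x).+1.
have xn : x <= n%:R by rewrite ltW// truncnS_gt.
(* [t `^ x <= 1 + t ^+ n], and [(t / 2) ^+ n / n`!] is a term of the series of
   [expR (t / 2)]. *)
exists (1 + n`!%:R * 2 ^+ n) => [|t t0].
  by rewrite addr_ge0// mulr_ge0// exprn_ge0.
have -> : expR (- t) = expR (- (2^-1 * t)) * expR (- (2^-1 * t)).
  by rewrite -expRD; congr expR; field.
rewrite mulrA ler_wpM2r ?expR_ge0//.
have h1 : t `^ x <= 1 + t ^+ n.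
  have [t1|t1] := leP t 1.
    rewrite ler_wpDr ?exprn_ge0//.
    have -> : 1 = 1 `^ x :> R by rewrite powR1.
    by rewrite ge0_ler_powR ?nnegrE.
  rewrite ler_wpDl// -powR_mulrn//.
  by rewrite ler_powR// ltW.
have e1 : expR (- (2^-1 * t)) <= 1.
  by rewrite expR_le1 oppr_le0 mulr_ge0.
have h2 : t ^+ n * expR (- (2^-1 * t)) <= n`!%:R * 2 ^+ n.
  rewrite expRN ler_pdivrMr ?expR_gt0// -mulrA mulrC.
  have : (2^-1 * t) ^+ n / n`!%:R <= expR (2^-1 * t).
    by apply: le_expR_monomial; rewrite mulr_ge0.
  rewrite ler_pdivrMr ?ltr0n ?fact_gt0// exprMn exprVn [leLHS]mulrC ler_pdivrMr ?exprn_gt0//.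
  by move=> h; apply: le_trans h _; rewrite le_eqVlt; apply/orP; left; apply/eqP; ring.
apply: le_trans (_ : (1 + t ^+ n) * expR (- (2^-1 * t)) <= _).
  by rewrite ler_wpM2r ?expR_ge0.
by rewrite mulrDl mul1r lerD.
Qed.

Lemma measurable_powR_expR x :
  measurable_fun pos (fun t => t `^ x * expR (- t)).
Proof.
apply: measurable_funM; apply: measurable_funTS; first exact: measurable_powR.
by apply: (measurableT_comp (f := @expR R)) => //; exact: measurable_funN.
Qed.

Lemma integrable_powR_expR x : 0 <= x ->
  mu.-integrable pos (EFin \o (fun t => t `^ x * expR (- t))).
Proof.
move=> x0; have [C C0 hC] := powR_expR_bound x0.
have := integrableZl measurable_pos C (integral_expR_scale half_gt0).1.
apply: le_integrable => //.
  by apply/measurable_EFinP; exact: measurable_powR_expR.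
move=> t /=; rewrite in_itv/= andbT => t0; rewrite lee_fin.
rewrite !ger0_norm ?mulr_ge0 ?expR_ge0 ?powR_ge0//.
by apply: hC; exact: ltW.
Qed.

Lemma GammaE x : Gamma (1 + x) = \int[mu]_(t in pos) (t `^ x * expR (- t)).
Proof. by rewrite /Gamma; apply: eq_Rintegral => t _; rewrite addrAC subrr add0r. Qed.

(** Integration by parts. The derivative of [t `^ (1 + x) * expR (- t)] changes
    sign, so a multiple of [expR (- (2^-1 * t))] is added to make it
    nonnegative. *)
Lemma Gamma1Dx1 x : 0 <= x -> Gamma (1 + (1 + x)) = (1 + x) * Gamma (1 + x).
Proof.
move=> x0.
have x10 : 0 < 1 + x by rewrite ltr_pwDl.
have [C C0 hC] := powR_expR_bound (ltW x10).
pose h t := (1 + x) * (t `^ x * expR (- t)) - t `^ (1 + x) * expR (- t).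
pose f t := h t + C * expR (- (2^-1 * t)).
pose F t := t `^ (1 + x) * expR (- t) + C * (- 2^-1^-1 * expR (- (2^-1 * t))).
have cpow y t : 0 < t -> {for t, continuous (fun t => t `^ y * expR (- t))}.
  move=> t0; apply: continuousM.
    apply: differentiable_continuous; apply/derivable1_diffP.
    by apply: derivable_powR; rewrite in_itv/= andbT.
  apply: continuous_comp; last exact: continuous_expR.
  by apply: continuousN; exact: cvg_id.
have cpow0 y : 0 <= y -> t `^ y * expR (- t) @[t --> 0^'+] --> 0 `^ y * expR (- 0).
  rewrite le_eqVlt => y0; apply: cvgM; last first.
    apply/cvg_at_right_filter; apply: continuous_comp; last exact: continuous_expR.
    by apply: continuousN; exact: cvg_id.
  case/predU1P: y0 => [<-|y0].
    under eq_cvg do rewrite powRr0.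
    by rewrite powRr0; exact: cvg_cst.
  rewrite powR0; last by rewrite gt_eqF.
  exact: powR_cvg0.
have dpow t : 0 < t -> is_derive t 1 (fun t => t `^ (1 + x) * expR (- t)) (h t).
  move=> t0.
  have d1 := @is_derive1_powR R (1 + x) t t0.
  have d2 : is_derive t 1 (expR \o -%R) (- expR (- t)).
    by rewrite -mulrN1; apply: is_derive1_comp.
  have := is_deriveM d1 d2; rewrite [X in is_derive _ _ _ X](_ : _ = h t)//.
  rewrite /h /GRing.scale/= [1 + x - 1]addrAC subrr add0r; ring.
have [||||||_ IF] := @integral_pos_FTC f F 0.
- move=> t t0; rewrite /f /h addrAC -addrA addr_ge0//.
    by rewrite !mulr_ge0 ?powR_ge0 ?expR_ge0// ltW.
  by rewrite subr_ge0; exact: hC.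
- move=> t t0; apply: (@continuousD _ _ _ h (fun t => C * expR (- (2^-1 * t))) t).
    apply: continuousB; last exact: cpow.
    by apply: continuousM; [exact: cst_continuous|exact: cpow].
  by apply: continuousM; [exact: cst_continuous|exact: continuous_expR_scale].
- apply: cvgD.
    apply: cvgB; last by apply: cpow0; exact: ltW.
    by apply: cvgM; [exact: cvg_cst|exact: cpow0].
  apply: cvgM; first exact: cvg_cst.
  by apply/cvg_at_right_filter; exact: continuous_expR_scale.
- move=> t t0; have d1 := dpow t t0; have d2 := @is_derive_expR_scale 2^-1 t (lt0r_neq0 half_gt0).
  exact: (is_deriveD d1 (is_deriveZ C d2)).
- apply: cvgD; first by apply: cpow0; exact: ltW.
  apply: cvgM; first exact: cvg_cst.
  apply: cvgM; first exact: cvg_cst.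
  by apply/cvg_at_right_filter; exact: continuous_expR_scale.
- rewrite [X in _ --> X](_ : _ = 0 + C * (- 2^-1^-1 * 0)); last by rewrite !mulr0 addr0.
  apply: cvgD; last first.
    by apply: cvgM; [exact: cvg_cst|apply: cvgM; [exact: cvg_cst|exact: cvg_expR_scale]].
  apply: (@squeeze_cvgr _ _ _ _ (fun=> 0) (fun t => C * expR (- (2^-1 * t)))).
  + near=> t; have t0 : 0 <= t by near: t; exact: nbhs_pinfty_ge.
    by rewrite mulr_ge0 ?powR_ge0 ?expR_ge0//= hC.
  + exact: cvg_cst.
  + by rewrite -[0](mulr0 C); apply: cvgM; [exact: cvg_cst|exact: cvg_expR_scale].
have I0 := integrable_powR_expR x0.
have I1 := integrable_powR_expR (ltW x10).
have I0' : mu.-integrable pos (EFin \o (fun t => (1 + x) * (t `^ x * expR (- t)))).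
  exact: integrableZl I0.
have IC : mu.-integrable pos (EFin \o (fun t => C * expR (- (2^-1 * t)))).
  exact: integrableZl (integral_expR_scale half_gt0).1.
have Ih : mu.-integrable pos (EFin \o h).
  exact: integrableB I0' I1.
move: IF; rewrite /f RintegralD// RintegralZl//; last exact: (integral_expR_scale half_gt0).1.
rewrite (integral_expR_scale half_gt0).2 /h RintegralB// RintegralZl// !GammaE.
rewrite /F powR0 ?gt_eqF// mul0r mulr0 oppr0 expR0 invrK; lra.
Unshelve. all: by end_near. Qed.

(** The tangent line at [b] of the convex function [t `^ (- y)]. *)
Lemma powR_tangent (y b t : R) : 0 <= y -> 0 < b -> 0 < t ->
  b `^ (- y) * (1 + y - y * (t / b)) <= t `^ (- y).
Proof.
move=> y0 b0 t0.
have tb0 : 0 < t / b by rewrite divr_gt0.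
have -> : t `^ (- y) = b `^ (- y) * (t / b) `^ (- y).
  rewrite -powRM; [|exact: ltW|exact: ltW].
  by rewrite mulrC divfK// gt_eqF.
rewrite ler_wpM2l ?powR_ge0// /powR gt_eqF//.
apply: le_trans (expR_ge1Dx _).
have h : ln (t / b) <= t / b - 1.
  have e : t / b = 1 + (t / b - 1) by ring.
  by rewrite [in leLHS]e le_ln1Dx// ltrBrDl subrr.
have : y * ln (t / b) <= y * (t / b - 1) by rewrite ler_wpM2l.
rewrite mulrBr; lra.
Qed.

(** Jensen's inequality for the convex function [t `^ (- y)] under the density
    proportional to [t `^ (x + y) * expR (- t)], whose mean is
    [1 + (x + y)]. *)
Lemma Gamma_tangent x y : 0 <= x -> 0 <= y ->
  (1 + (x + y)) `^ (- y) * Gamma (1 + (x + y)) <= Gamma (1 + x).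
Proof.
move=> x0 y0; set b := 1 + (x + y).
have xy0 : 0 <= x + y by rewrite addr_ge0.
have b0 : 0 < b by rewrite ltr_pwDl.
have I0 := integrable_powR_expR xy0.
have I1 := integrable_powR_expR (ltW b0).
have J0 := integrableZl measurable_pos (b `^ (- y) * (1 + y)) I0.
have J1 := integrableZl measurable_pos (b `^ (- y) * (y / b)) I1.
have -> : b `^ (- y) * Gamma b =
    \int[mu]_(t in pos) ((b `^ (- y) * (1 + y)) * (t `^ (x + y) * expR (- t)) -
      (b `^ (- y) * (y / b)) * (t `^ b * expR (- t))).
  rewrite RintegralB// !RintegralZl// -!GammaE Gamma1Dx1// -/b.
  by field; rewrite gt_eqF.
rewrite GammaE; apply: le_Rintegral => //.
- exact: integrableB J0 J1.
- exact: integrable_powR_expR.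
move=> t /=; rewrite in_itv/= andbT => t0.
have tn0 : t != 0 by rewrite gt_eqF.
have -> : t `^ b = t * t `^ (x + y).
  have := @powRD R t 1 (x + y); rewrite tn0 implybT => /(_ isT) ->.
  by rewrite powRr1 // ltW.
have -> : t `^ x = t `^ (x + y) * t `^ (- y).
  by rewrite -powRD ?tn0 ?implybT// addrK.
have := powR_tangent y0 b0 t0.
have c0 : 0 <= t `^ (x + y) * expR (- t) by rewrite mulr_ge0 ?powR_ge0 ?expR_ge0.
move=> /(ler_wpM2l c0) h; rewrite [leRHS]mulrAC; apply: le_trans h.
by rewrite le_eqVlt; apply/orP; left; apply/eqP; field; rewrite gt_eqF.
Qed.

Lemma Gamma1 : Gamma 1 = 1 :> R.
Proof.
have e1 := (integral_expR_scale ltr01).2.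
have := GammaE 0; rewrite addr0 => ->; rewrite -[RHS]invr1 -e1; apply: eq_Rintegral => t _.
by rewrite powRr0 !mul1r.
Qed.

Lemma Gamma1Dn n : Gamma (1 + n%:R) = n`!%:R :> R.
Proof.
elim: n => [|n IH]; first by rewrite addr0 Gamma1.
by rewrite -natr1 [n%:R + 1]addrC Gamma1Dx1// IH factS natrM nat1r.
Qed.

Lemma Gamma1DnDx n x : 0 <= x ->
  Gamma (1 + (n%:R + x)) = Gamma (1 + x) * \prod_(i < n) (i.+1%:R + x).
Proof.
move=> x0; elim: n => [|n IH]; first by rewrite add0r big_ord0 mulr1.
rewrite -natr1 [n%:R + 1]addrC -addrA Gamma1Dx1 ?addr_ge0// IH big_ord_recr/=.
by rewrite -natr1; ring.
Qed.

(** Comparison with the factorial of the next integer through [Gamma_tangent].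
    It bounds the coefficients of the Mittag-Leffler series. *)
Lemma Gamma1Dx_ge_half x : 0 <= x -> 2^-1 <= Gamma (1 + x).
Proof.
move=> x0; pose n := (Num.truncn x).+1.
have xn : x <= n%:R by rewrite ltW// truncnS_gt.
have nx : n%:R - x <= 1.
  by rewrite lerBlDr -nat1r lerD2l truncn_le.
have := @Gamma_tangent x (n%:R - x) x0; rewrite subr_ge0 => /(_ xn).
rewrite [x + _]addrC subrK Gamma1Dn; apply: le_trans.
rewrite powRN mulrC ler_pdivlMr ?powR_gt0 ?ltr_pwDl//.
apply: (@le_trans _ _ (2^-1 * (1 + n%:R))).
  by rewrite ler_wpM2l// ler1_powR// lerDl.
rewrite mulrC ler_pdivrMr// nat1r -natrM ler_nat.
rewrite /n factS -mulnA; set k := Num.truncn x.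
apply: (@leq_trans (k.+1 * 2)); first by rewrite muln2 doubleS !ltnS -addnn leq_addr.
by rewrite leq_mul2l leq_pmull ?fact_gt0 // orbT.
Qed.

Lemma Gamma1Dx_gt0 x : 0 <= x -> 0 < Gamma (1 + x).
Proof. by move=> /Gamma1Dx_ge_half; apply: lt_le_trans; rewrite invr_gt0. Qed.

End euler_integral.

(** * The Gauss product *)

Section gauss_product.
Variable R : realType.
Implicit Types (x : R) (n : nat).

Lemma cvg_invn_scale (a : R) : (fun n : nat => a / n%:R : R) @ \oo --> (0 : R).
Proof.
rewrite -[X in _ --> X](mulr0 a); apply: cvgM; first exact: cvg_cst.
apply/gtr0_cvgV0; last exact: cvgr_idn.
by near=> n; rewrite ltr0n; near: n; exact: nbhs_infty_gt.
Unshelve. all: by end_near. Qed.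

Lemma cvg_powR1 (u : nat -> R) x : u @ \oo --> (1 : R) ->
  (fun n => u n `^ x) @ \oo --> (1 : R).
Proof.
move=> u1; rewrite [X in _ --> X](_ : _ = 1 `^ x); last by rewrite powR1.
apply: (@continuous_cvg _ _ _ _ _ _ (fun z : R => z `^ x)) => //.
apply: differentiable_continuous; apply/derivable1_diffP.
by apply: derivable_powR; rewrite in_itv/= andbT.
Qed.

(** [Gamma_tangent] between [n] and [n + x] gives the upper bound and, between
    [n + x] and an integer beyond it, the lower bound; at integers the Gamma
    function is a factorial. *)
Lemma Gamma_ratio_cvg x : 0 <= x ->
  (fun n => Gamma (1 + (n%:R + x)) / (n`!%:R * n%:R `^ x)) @ \oo --> (1 : R).
Proof.
move=> x0; pose N := (Num.truncn x).+1.
have xN : x <= N%:R by rewrite ltW// truncnS_gt.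
have Nx0 : 0 <= N%:R - x by rewrite subr_ge0.
have nf n : 0 < n`!%:R :> R by rewrite ltr0n fact_gt0.
apply: (@squeeze_cvgr _ _ _ _ (fun n => (n%:R / (1 + (n%:R + N%:R))) `^ (N%:R - x))
   (fun n => ((1 + (n%:R + x)) / n%:R) `^ x)).
- near=> n.
  have n0 : 0 < n%:R :> R by rewrite ltr0n; near: n; exact: nbhs_infty_gt.
  have b1 : 0 < 1 + (n%:R + N%:R) :> R by rewrite ltr_pwDl// addr_ge0.
  have b2 : 0 < 1 + (n%:R + x) :> R by rewrite ltr_pwDl// addr_ge0.
  apply/andP; split.
    have := Gamma_tangent (addr_ge0 (ler0n R n) x0) Nx0.
    have -> : n%:R + x + (N%:R - x) = n%:R + N%:R by ring.
    rewrite -natrD Gamma1Dn natrD => h.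
    rewrite ler_pdivlMr ?mulr_gt0 ?powR_gt0//; apply: le_trans h.
    have fN : n`!%:R * n%:R ^+ N <= (n + N)`!%:R :> R.
      rewrite -natrX -natrM ler_nat; elim: (N) => [|k IH]; first by rewrite addn0 muln1.
      rewrite addnS factS expnS mulnCA; apply: leq_mul => //.
      by rewrite -addnS leq_addr.
    have eN : n%:R `^ x * n%:R `^ (N%:R - x) = n%:R ^+ N :> R.
      rewrite -powRD; last by rewrite (gt_eqF n0) implybT.
      by rewrite addrCA subrr addr0 powR_mulrn.
    have -> : (n%:R / (1 + (n%:R + N%:R))) `^ (N%:R - x) * (n`!%:R * n%:R `^ x) =
        (1 + (n%:R + N%:R)) `^ (- (N%:R - x)) * (n`!%:R * n%:R ^+ N) :> R.
      rewrite -eN powRM ?invr_ge0 ?(ltW b1)//.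
      rewrite -(powR_inv1 (ltW b1)) -powRrM mulN1r.
      by ring.
    by rewrite ler_wpM2l ?powR_ge0.
  have := Gamma_tangent (ler0n R n) x0.
  rewrite Gamma1Dn powRN => h.
  rewrite ler_pdivrMr ?mulr_gt0 ?powR_gt0//.
  have -> : ((1 + (n%:R + x)) / n%:R) `^ x * (n`!%:R * n%:R `^ x) =
      n`!%:R * (1 + (n%:R + x)) `^ x :> R.
    rewrite powRM ?invr_ge0 ?(ltW b2)// -(powR_inv1 (ltW n0)) -powRrM mulN1r powRN.
    by field; rewrite gt_eqF// powR_gt0.
  by rewrite -ler_pdivrMr ?powR_gt0// mulrC.
- apply: cvg_powR1.
  rewrite [X in _ --> X](_ : _ = (1 : R)^-1); last by rewrite invr1.
  apply: cvg_trans (_ : (fun n => (1 + (1 + N%:R) / n%:R)^-1) @ \oo --> _).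
    apply: near_eq_cvg; near=> n.
    have n0 : 0 < n%:R :> R by rewrite ltr0n; near: n; exact: nbhs_infty_gt.
    have b1 : 0 < 1 + (n%:R + N%:R) :> R by rewrite ltr_pwDl// addr_ge0.
    have b2 : 0 < n%:R + (1 + N%:R) :> R by rewrite ltr_pwDl// addr_ge0.
    by field; rewrite !gt_eqF.
  apply: cvgV; rewrite ?oner_eq0//.
  rewrite -[X in _ --> X](addr0 1); apply: cvgD; first exact: cvg_cst.
  exact: cvg_invn_scale.
- apply: cvg_powR1.
  apply: cvg_trans (_ : (fun n => 1 + (1 + x) / n%:R) @ \oo --> _).
    apply: near_eq_cvg; near=> n.
    have n0 : 0 < n%:R :> R by rewrite ltr0n; near: n; exact: nbhs_infty_gt.
    by field; rewrite gt_eqF.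
  rewrite -[X in _ --> X](addr0 1); apply: cvgD; first exact: cvg_cst.
  exact: cvg_invn_scale.
Unshelve. all: by end_near. Qed.

(** By the functional equation the product is
    $\Gamma(1 + n + x) / (n! \Gamma(1 + x))$, and
    $\Gamma(1 + n + x) \sim n! n^x$. *)
Lemma cvg_gauss_product x : 0 <= x ->
  (fun n => (\prod_(i < n) (1 + x / i.+1%:R)) / n%:R `^ x) @ \oo -->
  (Gamma (1 + x))^-1.
Proof.
move=> x0.
rewrite [X in X @ _](_ : _ = fun n => (Gamma (1 + x))^-1 *
    (Gamma (1 + (n%:R + x)) / (n`!%:R * n%:R `^ x))); last first.
  apply/funext => n; rewrite Gamma1DnDx// mulrA [_ * (Gamma _ * _)]mulrA.
  rewrite mulVf ?gt_eqF ?Gamma1Dx_gt0// mul1r invfM mulrA; congr (_ / _).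
  elim: n => [|n IH]; first by rewrite !big_ord0 divr1.
  rewrite !big_ord_recr/= IH factS natrM.
  by field; rewrite -[1 + _]/(1%:R + _) -natrD !pnatr_eq0 -lt0n fact_gt0.
rewrite -[X in _ --> X]mulr1; apply: cvgM; first exact: cvg_cst.
exact: Gamma_ratio_cvg.
Qed.

End gauss_product.

(** * Finite partitions of a probability space *)

Section finite_splitting.
Context d (T : measurableType d) (R : realType) (P : probability T R).
Implicit Types (A B : set T).

Definition pr A : R := fine (P A).

Lemma prE A : measurable A -> P A = (pr A)%:E.
Proof. by move=> mA; rewrite /pr fineK// fin_num_measure. Qed.

Lemma pr_ge0 A : 0 <= pr A. Proof. by rewrite /pr fine_ge0. Qed.

Lemma prD A B : measurable A -> measurable B -> A `<=` B ->
  pr (B `\` A) = pr B - pr A.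
Proof.
move=> mA mB AB.
have Boo : (P B < +oo)%E by rewrite (prE mB) ltry.
have e : P (B `\` A) = (P B - P A)%E by rewrite (measureD mB mA Boo) setIidr.
by rewrite /pr e fineB// fin_num_measure.
Qed.

Lemma pr_sum_le (I : eqType) (s : seq I) (A : I -> set T) B : uniq s ->
  measurable B -> (forall i, i \in s -> measurable (A i)) ->
  (forall i, i \in s -> A i `<=` B) ->
  (forall i j, i \in s -> j \in s -> i != j -> A i `&` A j = set0) ->
  \sum_(i <- s) pr (A i) <= pr B.
Proof.
elim: s B => [|i s IH] B /=; first by rewrite big_nil pr_ge0.
move=> /andP[iNs us] mB mA AB dA; rewrite big_cons.
have mi : measurable (A i) by apply: mA; rewrite mem_head.
have iB : A i `<=` B by apply: AB; rewrite mem_head.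
have := IH (B `\` A i) us (measurableD mB mi).
rewrite prD// -lerBrDl; apply.
- by move=> j js; apply: mA; rewrite inE js orbT.
- move=> j js w Aj; split; first by apply: AB Aj; rewrite inE js orbT.
  move=> Ai; suff : (A i `&` A j) w by rewrite dA ?mem_head// ?inE ?js ?orbT//; apply: contraNneq iNs => ->.
  by [].
- by move=> j k js ks; apply: dA; rewrite inE ?js ?ks orbT.
Qed.

(** A disjoint family of full probability in [B] need not cover [B], but what
    it misses is negligible. *)
Lemma Rintegral_split (I : eqType) (s : seq I) (A : I -> set T) B (F : T -> R) :
  uniq s ->
  measurable B -> (forall i, i \in s -> measurable (A i)) ->
  (forall i, i \in s -> A i `<=` B) ->
  (forall i j, i \in s -> j \in s -> i != j -> A i `&` A j = set0) ->
  P.-integrable B (EFin \o F) -> \sum_(i <- s) pr (A i) = pr B ->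
  \int[P]_(w in B) F w = \sum_(i <- s) \int[P]_(w in A i) F w.
Proof.
elim: s B => [|i s IH] B /=.
  rewrite !big_nil => _ mB _ _ _ IF B0.
  rewrite /Rintegral null_set_integral//; first exact: measurable_int IF.
  by have := prE mB; rewrite -B0.
move=> /andP[iNs us] mB mA AB dA IF; rewrite !big_cons => sB.
have mi : measurable (A i) by apply: mA; rewrite mem_head.
have iB : A i `<=` B by apply: AB; rewrite mem_head.
rewrite -{1}(setDUK iB) Rintegral_setU//; last 3 first.
- exact: measurableD.
- by rewrite setDUK.
- by apply/disj_setPS => w [? []].
congr (_ + _); apply: IH => //.
- exact: measurableD.
- by move=> j js; apply: mA; rewrite inE js orbT.
- move=> j js w Aj; split; first by apply: AB Aj; rewrite inE js orbT.
  move=> Ai; suff : (A i `&` A j) w by rewrite dA ?mem_head// ?inE ?js ?orbT//; apply: contraNneq iNs => ->.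
  by [].
- by move=> j k js ks; apply: dA; rewrite inE ?js ?ks orbT.
- by apply: integrableS IF => //; exact: measurableD.
- by rewrite prD// -sB addrC addKr.
Qed.

End finite_splitting.

Section paths.
Variable R : realType.

Definition steps : seq R := [:: 1; -1; 0].

(** The latest step comes first, so that prolonging a path is a [cons]. *)
Fixpoint paths n : seq (seq R) :=
  if n is m.+1 then [seq b :: l | l <- paths m, b <- steps] else [:: [::]].

Lemma steps_uniq : uniq steps.
Proof.
rewrite /= !inE !negb_or !andbT oner_eq0 oppr_eq0 oner_eq0/= !andbT.
by rewrite -subr_eq0 opprK -[1 + 1]/(2%:R) pnatr_eq0.
Qed.

Lemma paths_uniq n : uniq (paths n).
Proof.
elim: n => [//|n IH].
apply: (@allpairs_uniq _ _ _ (fun l b => b :: l)) => //; first exact: steps_uniq.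
by move=> [l b] [l' b'] _ _ /= [-> ->].
Qed.

Lemma mem_paths n l : l \in paths n -> size l = n /\ all (mem steps) l.
Proof.
elim: n l => [|n IH] l; first by rewrite inE => /eqP ->.
by move=> /allpairsP[[l' b] [/= /IH[<- al'] bs ->]] /=; rewrite bs.
Qed.

Lemma sum_pathsS n (F : seq R -> R) :
  \sum_(l <- paths n.+1) F l = \sum_(l <- paths n) \sum_(b <- steps) F (b :: l).
Proof. by rewrite [LHS]big_allpairs_dep. Qed.

End paths.

(** * The law of the trajectories *)

Section path_law.
Variables (R : realType) (p q r s : R).
Context d (T : measurableType d) (P : probability T R).
Variable X : nat -> {RV P >-> R}.

Definition path_event (l : seq R) : set T :=
  past (fun i => X i) (size l) (fun i => nth 0 l (size l - i)).

Lemma path_event_nil : path_event [::] = setT.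
Proof. by apply/seteqP; split => // w _ i; rewrite leqn0; case: i. Qed.

Lemma path_event_cons b l :
  path_event (b :: l) = path_event l `&` [set w | X (size l).+1 w = b].
Proof.
apply/seteqP; split => w /=.
  move=> h; split; last by rewrite h ?ltnS ?leqnn//= subnn.
  move=> i /andP[i1 il]; rewrite h /= ?i1 ?(leqW il)//.
  by rewrite subSn.
move=> [h e] i /andP[i1]; rewrite /= leq_eqVlt => /predU1P[->|].
  by rewrite subnn.
by rewrite ltnS => il; rewrite h ?i1// subSn.
Qed.

Lemma measurable_path_event l : measurable (path_event l).
Proof.
elim: l => [|b l IH]; first by rewrite path_event_nil.
rewrite path_event_cons; apply: measurableI => //.
have := measurable_funP (X (size l).+1) measurableT [set b] (measurable_set1 b).
by rewrite setTI.
Qed.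

Lemma path_event_disjoint l l' : size l = size l' -> l != l' ->
  path_event l `&` path_event l' = set0.
Proof.
move=> sl /eqP ll'; rewrite -subset0 => w [h h']; apply: ll'.
apply: (@eq_from_nth _ 0) => // i il.
have i1 : (1 <= size l - i <= size l)%N by rewrite subn_gt0 il leq_subr.
have := h _ i1; have := h' (size l - i)%N; rewrite -sl => /(_ i1) ->.
by rewrite subKn// ltnW.
Qed.

Hypothesis hpqr : p + q + r = 1.

(** The conditional law of the step that follows the path [l]: an entry [x] of
    [l] chosen uniformly, multiplied by an independent factor [a]. *)
Definition step_kernel (l : seq R) b : R :=
  (size l)%:R^-1 * \sum_(x <- l) \sum_(a <- @steps R) (a * x == b)%:R * step_law p q r a.

Let n1 : (-1 == 1 :> R) = false.
Proof. by apply/negbTE; rewrite eq_sym -subr_eq0 opprK -[1 + 1]/(2%:R) pnatr_eq0. Qed.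
Let n1' : (1 == -1 :> R) = false. Proof. by rewrite eq_sym. Qed.
Let m0 : (-1 == 0 :> R) = false. Proof. by rewrite oppr_eq0 oner_eq0. Qed.
Let m0' : (0 == -1 :> R) = false. Proof. by rewrite eq_sym m0. Qed.
Let o0 : (0 == 1 :> R) = false. Proof. by rewrite eq_sym oner_eq0. Qed.

Lemma sum_steps (F : R -> R) : \sum_(a <- @steps R) F a = F 1 + F (-1) + F 0.
Proof. by rewrite /steps !big_cons big_nil addr0 addrA. Qed.

Let step_entry (x : R) : x \in @steps R ->
  [/\ \sum_(a <- @steps R) (a * x == 1)%:R * step_law p q r a =
        ((p + q) * x ^+ 2 + (p - q) * x) / 2,
      \sum_(a <- @steps R) (a * x == -1)%:R * step_law p q r a =
        ((p + q) * x ^+ 2 - (p - q) * x) / 2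
    & \sum_(a <- @steps R) (a * x == 0)%:R * step_law p q r a =
        1 - (p + q) * x ^+ 2].
Proof.
rewrite /step_law !sum_steps !inE => /or3P[]/eqP->;
  rewrite ?mulr1 ?mulrN1 ?mulr0 ?opprK ?oppr0 ?eqxx ?n1 ?n1' ?m0 ?m0' ?o0 ?oner_eq0 ?eqxx /=;
  split; rewrite ?n1 ?n1' ?m0 ?m0' ?o0 ?eqxx ?oner_eq0/=;
  have := hpqr; rewrite ?sqrrN ?expr1n ?expr0n /=; lra.
Qed.

Lemma step_kernel_sum l : l != [::] -> all (mem (@steps R)) l ->
  \sum_(b <- @steps R) step_kernel l b = 1.
Proof.
move=> l0 /allP al; rewrite sum_steps /step_kernel -!mulrDr -!big_split/=.
rewrite (eq_big_seq (fun=> 1)) => [|x /al /step_entry[-> -> ->]]; last by field.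
rewrite big_const_seq count_predT iter_addr_0 mulVf//.
by rewrite pnatr_eq0 size_eq0.
Qed.

Definition path_sum (l : seq R) : R := \sum_(x <- l) x.
Definition path_ones (l : seq R) : nat := count (fun x => x != 0) l.

Lemma sqr_path_ones l : all (mem (@steps R)) l ->
  \sum_(x <- l) x ^+ 2 = (path_ones l)%:R.
Proof.
elim: l => [|x l IH] /=; first by rewrite big_nil.
move=> /andP[xs /IH e]; rewrite big_cons e natrD; congr (_ + _).
by move: xs; rewrite !inE => /or3P[]/eqP->; rewrite ?sqrrN ?expr1n ?expr0n ?oppr_eq0 ?oner_eq0 ?eqxx.
Qed.

Lemma step_kernelE l : all (mem (@steps R)) l ->
  [/\ step_kernel l 1 =
        ((p + q) * (path_ones l)%:R + (p - q) * path_sum l) / (2 * (size l)%:R),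
      step_kernel l (-1) =
        ((p + q) * (path_ones l)%:R - (p - q) * path_sum l) / (2 * (size l)%:R)
    & step_kernel l 0 = (size l)%:R^-1 * ((size l)%:R - (p + q) * (path_ones l)%:R)].
Proof.
move=> al; rewrite -(sqr_path_ones al) /path_sum /step_kernel; move/allP : al => al.
split.
- rewrite (eq_big_seq (fun x => ((p + q) * x ^+ 2 + (p - q) * x) / 2)); last first.
    by move=> x /al /step_entry[].
  by rewrite -mulr_suml big_split/= -!mulr_sumr invfM; ring.
- rewrite (eq_big_seq (fun x => ((p + q) * x ^+ 2 - (p - q) * x) / 2)); last first.
    by move=> x /al /step_entry[].
  by rewrite -mulr_suml sumrB/= -!mulr_sumr invfM; ring.
- rewrite (eq_big_seq (fun x => 1 - (p + q) * x ^+ 2)); last first.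
    by move=> x /al /step_entry[].
  rewrite sumrB/= -!mulr_sumr; congr (_ * (_ - _)).
  by rewrite big_const_seq count_predT iter_addr_0.
Qed.

Hypothesis hX : is_ERWS p q r s X.

Lemma pr_path_event_nil : pr P (path_event [::]) = 1.
Proof. by rewrite path_event_nil /pr; have /(congr1 fine) := probability_setT P. Qed.

(** Summing the prescribed masses of the pairs (remembered time, factor) that
    lead to [b] bounds the probability from below. These bounds add up, over
    [b], to the probability of the whole event [path_event l], so none of them
    is strict. *)
Lemma pr_path_event_cons l b : l != [::] -> all (mem (@steps R)) l ->
  b \in @steps R ->
  pr P (path_event (b :: l)) = step_kernel l b * pr P (path_event l).
Proof.
move=> l0 al bs.
pose n := size l; have n0 : (1 <= n)%N by rewrite lt0n size_eq0.
case: hX => _ _ [K [xi HK]]; have [HX HP] := HK n n0.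
(* The pairs (remembered time, factor) that produce [b]; the step made at time
   [k] is the entry [n - k] of [l]. *)
pose pairs b := [seq ka <- [seq (k, a) | k <- iota 1 n, a <- @steps R] |
  ka.2 * nth 0 l (n - ka.1) == b].
pose A (ka : nat * R) := path_event l `&` [set w | K n w = ka.1] `&`
  [set w | xi n w = ka.2].
have mA ka : measurable (A ka).
  apply: measurableI; first apply: measurableI; first exact: measurable_path_event.
    have := measurable_funP (K n) measurableT [set ka.1].
    by rewrite setTI; apply.
  have := measurable_funP (xi n) measurableT [set ka.2] (measurable_set1 _).
  by rewrite setTI.
have lower b' : step_kernel l b' * pr P (path_event l) <= pr P (path_event (b' :: l)).
  have := @pr_sum_le _ _ _ P _ (pairs b') A (path_event (b' :: l)).
  have -> : \sum_(i <- pairs b') pr P (A i) = step_kernel l b' * pr P (path_event l).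
    rewrite big_filter big_mkcond big_allpairs_dep/= /step_kernel -/n.
    rewrite [in RHS](big_nth 0) big_mkord -(big_mkord xpredT
      (fun i => \sum_(a <- @steps R) (a * nth 0 l i == b')%:R * step_law p q r a)).
    rewrite [in RHS]big_nat_rev/= add0n -/n.
    transitivity (\sum_(1 <= k < n.+1) \sum_(a <- @steps R)
        (a * nth 0 l (n - k) == b')%:R * (pr P (path_event l) * (n%:R^-1 * step_law p q r a))).
      rewrite /index_iota subn1/=; apply: eq_big_seq => k; rewrite mem_iota add1n => kn.
      apply: eq_bigr => a _; case: ifP => _; last by rewrite mul0r.
      by rewrite mul1r /pr /A HP//= fineM// fin_num_measure//; exact: measurable_path_event.
    rewrite big_add1/= [RHS]mulrAC [RHS]mulr_sumr; apply: eq_bigr => i _.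
    by rewrite [RHS]mulr_sumr; apply: eq_bigr => a _; ring.
  apply.
  - apply: filter_uniq; apply: allpairs_uniq; [exact: iota_uniq|exact: steps_uniq|].
    by move=> [? ?] [? ?] _ _.
  - exact: measurable_path_event.
  - by move=> ka _; exact: mA.
  - move=> ka; rewrite mem_filter => /andP[e].
    move=> /allpairsP[[k a] [+ _ ekn]]; rewrite mem_iota add1n ltnS => /= kn.
    move: e; rewrite ekn => /= /eqP <-.
    move=> w [[ev Kk] xa]; rewrite path_event_cons; split => //=.
    by move: Kk xa => /= Kk xa; rewrite HX xa Kk ev.
  - move=> [k a] [k' a'] _ _ ne; rewrite -subset0 => w [[[_ Kk] xa] [[_ Kk'] xa']].
    by case/eqP: ne; move: Kk Kk' xa xa' => /= <- <- <- <-.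
have upper : \sum_(b <- @steps R) pr P (path_event (b :: l)) <= pr P (path_event l).
  apply: (@pr_sum_le _ _ _ P _ _ (fun b => path_event (b :: l))).
  - exact: steps_uniq.
  - exact: measurable_path_event.
  - by move=> b' _; exact: measurable_path_event.
  - by move=> b' _; rewrite path_event_cons; exact: subIsetl.
  - move=> b1 b2 _ _ ne; apply: path_event_disjoint => //.
    by apply: contra ne => /eqP[->].
have := step_kernel_sum l0 al; move: upper; rewrite !sum_steps => upper ksum.
have := lower 1; have := lower (-1); have := lower 0.
have := congr1 (fun z => z * pr P (path_event l)) ksum; rewrite !mulrDl mul1r.
by move: bs; rewrite !inE => /or3P[]/eqP->; lra.
Qed.

Let pr_step1 b : pr P (path_event [:: b]) = pr P [set w | X 1%N w = b].
Proof. by rewrite path_event_cons path_event_nil setTI. Qed.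

(** The masses [s] and [1 - s] leave none for a first step [0]. *)
Lemma pr_path_event1 : [/\ pr P (path_event [:: 1]) = s,
  pr P (path_event [:: -1]) = 1 - s & pr P (path_event [:: 0]) = 0].
Proof.
case: hX => X1 X1' _.
have e1 : pr P (path_event [:: 1]) = s by rewrite pr_step1 /pr X1.
have e2 : pr P (path_event [:: -1]) = 1 - s by rewrite pr_step1 /pr X1'.
split => //; apply/eqP; rewrite eq_le pr_ge0 andbT.
have : \sum_(b <- @steps R) pr P (path_event [:: b]) <= pr P (path_event [::]).
  apply: (@pr_sum_le _ _ _ P _ _ (fun b => path_event [:: b])).
  - exact: steps_uniq.
  - exact: measurable_path_event.
  - by move=> b' _; exact: measurable_path_event.
  - by move=> b' _; rewrite path_event_cons; exact: subIsetl.
  - move=> b1 b2 _ _ ne; apply: path_event_disjoint => //.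
    by apply: contra ne => /eqP[->].
rewrite sum_steps e1 e2 pr_path_event_nil; lra.
Qed.

Definition chain_mean n (G : R -> nat -> R) : R :=
  \sum_(l <- @paths R n) pr P (path_event l) * G (path_sum l) (path_ones l).

Lemma path_sum_cons b l : path_sum (b :: l) = path_sum l + b.
Proof. by rewrite /path_sum big_cons addrC. Qed.

Lemma chain_mean1 G : chain_mean 1 G = s * G 1 1%N + (1 - s) * G (-1) 1%N.
Proof.
rewrite /chain_mean sum_pathsS big_seq1 sum_steps.
have [-> -> ->] := pr_path_event1; rewrite mul0r addr0.
by rewrite !path_sum_cons /path_sum big_nil !add0r /path_ones/= oner_eq0 oppr_eq0 oner_eq0.
Qed.

(** Among the [n] past steps, those equal to [1] and to [-1] number
    [(m + a) / 2] and [(m - a) / 2]. The position and the number of ones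
    therefore form a Markov chain, although the walk alone is not one. *)
Lemma chain_meanS n G : (0 < n)%N ->
  chain_mean n.+1 G = chain_mean n (fun a m =>
    ((p + q) * m%:R + (p - q) * a) / (2 * n%:R) * G (a + 1) m.+1 +
    ((p + q) * m%:R - (p - q) * a) / (2 * n%:R) * G (a - 1) m.+1 +
    n%:R^-1 * (n%:R - (p + q) * m%:R) * G a m).
Proof.
move=> n0; rewrite /chain_mean sum_pathsS; apply: eq_big_seq => l /mem_paths[sl al].
have l0 : l != [::] by rewrite -size_eq0 sl -lt0n.
have [k1 k2 k3] := step_kernelE al.
rewrite sum_steps !pr_path_event_cons ?inE ?eqxx ?orbT// k1 k2 k3 sl.
rewrite !path_sum_cons addr0 /path_ones/= oner_eq0 oppr_eq0 oner_eq0 eqxx/= !add1n add0n.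
by ring.
Qed.

Lemma pr_paths_sum n : \sum_(l <- @paths R n) pr P (path_event l) = 1.
Proof.
elim: n => [|n IH]; first by rewrite big_seq1 pr_path_event_nil.
rewrite sum_pathsS; case: n IH => [_|n IH].
  by rewrite big_seq1 sum_steps; have [-> -> ->] := pr_path_event1; ring.
rewrite -IH; apply: eq_big_seq => l /mem_paths[sl al].
have l0 : l != [::] by rewrite -size_eq0 sl.
have ksum := step_kernel_sum l0 al.
rewrite -[RHS]mul1r -ksum mulr_suml; apply: eq_big_seq => b bs.
exact: pr_path_event_cons.
Qed.

Lemma path_event_position l w : path_event l w ->
  position X (size l) w = path_sum l.
Proof.
elim: l => [|b l IH]; first by rewrite /position big_geq// /path_sum big_nil.
rewrite path_event_cons => -[/IH e /= Xb].
by rewrite /position big_nat_recr//= Xb path_sum_cons -e.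
Qed.

Lemma path_event_number_of_ones l w : all (mem (@steps R)) l -> path_event l w ->
  number_of_ones X (size l) w = (path_ones l)%:R.
Proof.
move=> al; rewrite -(sqr_path_ones al) => {al}.
elim: l => [|b l IH]; first by rewrite /number_of_ones big_geq// big_nil.
rewrite path_event_cons => -[/IH e /= Xb].
by rewrite /number_of_ones big_nat_recr//= Xb big_cons -e addrC.
Qed.

Lemma Rintegral_chain_mean n (h : R -> R -> R) :
  P.-integrable setT (EFin \o (fun w => h (position X n w) (number_of_ones X n w))) ->
  \int[P]_w h (position X n w) (number_of_ones X n w) =
  chain_mean n (fun a m => h a m%:R).
Proof.
move=> Ih; rewrite (@Rintegral_split _ _ _ P _ (@paths R n) path_event)//; last 4 first.
- exact: paths_uniq.
- by move=> l _; exact: measurable_path_event.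
- move=> l l' /mem_paths[sl _] /mem_paths[sl' _] ne.
  by apply: path_event_disjoint => //; rewrite sl sl'.
- by rewrite pr_paths_sum -path_event_nil pr_path_event_nil.
rewrite /chain_mean; apply: eq_big_seq => l /mem_paths[sl al].
rewrite (@eq_Rintegral _ _ _ _ _ (fun=> h (path_sum l) (path_ones l)%:R)); last first.
  move=> w; rewrite inE => lw.
  by rewrite -sl path_event_position// path_event_number_of_ones.
by rewrite (Rintegral_cst P (measurable_path_event l)) mulrC.
Qed.

Lemma measurable_position n : measurable_fun setT (position X n).
Proof. by apply: measurable_sum => k; exact: measurable_funPT. Qed.

Lemma measurable_number_of_ones n : measurable_fun setT (number_of_ones X n).
Proof. by apply: measurable_sum => k; apply: measurable_funX. Qed.

End path_law.

(** * The walk without stops *)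

Lemma cvg_sum_seq (R : realType) (I : eqType) (t : seq I) (F : I -> nat -> R)
    (l : I -> R) : (forall i, i \in t -> F i @ \oo --> l i) ->
  (fun n => \sum_(i <- t) F i n) @ \oo --> \sum_(i <- t) l i.
Proof.
elim: t => [|i t IH] Fl.
  rewrite big_nil; under eq_fun do rewrite big_nil; exact: cvg_cst.
rewrite big_cons; under eq_fun do rewrite big_cons.
apply: cvgD; first by apply: Fl; rewrite mem_head.
by apply: IH => j jt; apply: Fl; rewrite inE jt orbT.
Qed.

Section elephant_walk.
Variables (R : realType) (s c : R).
Implicit Types (m k i : nat) (f g : R -> R).

(** The mean of [g] at the position after [m] steps of the elephant random walk
    without stops, which leaves [a] at step [m] for [a + 1] or [a - 1] with
    probabilities $(1 \pm c a / m) / 2$. *)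
Fixpoint walk_mean m g : R :=
  if m is m'.+1 then
    if m' == 0%N then s * g 1 + (1 - s) * g (-1)
    else walk_mean m' (fun a => (1 + c * a / m'%:R) / 2 * g (a + 1) +
                                (1 - c * a / m'%:R) / 2 * g (a - 1))
  else g 0.

Lemma walk_meanS m g : (0 < m)%N ->
  walk_mean m.+1 g = walk_mean m (fun a => (1 + c * a / m%:R) / 2 * g (a + 1) +
                                (1 - c * a / m%:R) / 2 * g (a - 1)).
Proof. by case: m. Qed.

Lemma walk_mean_linear m x f g :
  walk_mean m (fun a => x * f a + g a) = x * walk_mean m f + walk_mean m g.
Proof.
elim: m f g => [//|m IH] f g /=; case: ifP => _; first by ring.
by rewrite -IH; congr (walk_mean m _); apply/funext => a; ring.
Qed.

Lemma walk_mean0 m : walk_mean m (fun=> 0) = 0.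
Proof.
have := walk_mean_linear m (-1) (fun=> 0) (fun=> 0).
rewrite [X in walk_mean m X = _](_ : _ = fun=> 0); first by move=> ->; ring.
by apply/funext => a; rewrite mulr0 addr0.
Qed.

Lemma walk_meanZ m x f : walk_mean m (fun a => x * f a) = x * walk_mean m f.
Proof.
rewrite -[RHS]addr0 -[X in _ + X](walk_mean0 m) -walk_mean_linear.
by congr (walk_mean m _); apply/funext => a; rewrite addr0.
Qed.

Lemma walk_mean_sum m (I : Type) (t : seq I) (F : I -> R -> R) :
  walk_mean m (fun a => \sum_(i <- t) F i a) = \sum_(i <- t) walk_mean m (F i).
Proof.
elim: t => [|i t IH].
  by rewrite big_nil -[RHS](walk_mean0 m); congr (walk_mean m _); apply/funext => a; rewrite big_nil.
rewrite big_cons -IH -[walk_mean m (F i)]mul1r -walk_mean_linear.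
by congr (walk_mean m _); apply/funext => a; rewrite big_cons mul1r.
Qed.

Definition walk_moment k m := walk_mean m (fun a => a ^+ k).

Let even_part i : R := (1 + (-1) ^+ i) / 2.
Let odd_part i : R := (1 - (-1) ^+ i) / 2.

(** Binomial expansion of $(a \pm 1)^k$: the even powers of the step have mean
    $1$ and the odd ones $c a / m$. *)
Lemma walk_momentS k m : (0 < m)%N ->
  walk_moment k m.+1 = \sum_(0 <= i < k.+1) 'C(k, i)%:R *
    (even_part i * walk_moment (k - i) m +
     c / m%:R * odd_part i * walk_moment (k - i).+1 m).
Proof.
move=> m0; rewrite /walk_moment walk_meanS//.
transitivity (walk_mean m (fun a => \sum_(0 <= i < k.+1)
    'C(k, i)%:R * (even_part i * a ^+ (k - i) +
     c / m%:R * odd_part i * a ^+ (k - i).+1))).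
  congr (walk_mean m _); apply/funext => a.
  rewrite !exprDn -!(big_mkord xpredT (fun i => a ^+ (k - i) * _ ^+ i *+ 'C(k, i))).
  rewrite !big_mkord 2!mulr_sumr -big_split/=; apply: eq_bigr => i _.
  rewrite /even_part /odd_part expr1n exprS -![(_ * _) *+ _]mulr_natr.
  by field; rewrite pnatr_eq0 -lt0n.
rewrite walk_mean_sum; apply: eq_bigr => i _.
rewrite walk_meanZ; congr (_ * _).
by rewrite walk_mean_linear walk_meanZ.
Qed.

Hypothesis c_half : c < 1 / 2.

Let sqrtn0 m : (0 < m)%N -> Num.sqrt m%:R != 0 :> R.
Proof. by move=> m0; rewrite gt_eqF// sqrtr_gt0 ltr0n. Qed.

Let cvg_inv_sqrt k : (fun m => (Num.sqrt m%:R ^+ k.+1)^-1 : R) @ \oo --> (0 : R).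
Proof.
have h : (fun m => (Num.sqrt m%:R)^-1 : R) @ \oo --> (0 : R).
  rewrite [X in X @ _](_ : _ = fun m => Num.sqrt (1 / m%:R)); last first.
    by apply/funext => m; rewrite div1r sqrtrV.
  rewrite [X in _ --> X](_ : _ = Num.sqrt 0); last by rewrite sqrtr0.
  apply: (@continuous_cvg _ _ _ _ _ _ (@Num.sqrt R)); last exact: cvg_invn_scale.
  exact: sqrt_continuous.
rewrite [X in _ --> X](_ : _ = 0 ^+ k.+1); last by rewrite expr0n.
rewrite [X in X @ _](_ : _ = fun m => (Num.sqrt m%:R)^-1 ^+ k.+1); last first.
  by apply/funext => m; rewrite exprVn.
apply: (@continuous_cvg _ _ _ _ _ _ (fun z : R => z ^+ k.+1)) h.
exact: exprn_continuous.
Qed.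

Lemma walk_mean_cst m x : walk_mean m (fun=> x) = x.
Proof.
elim: m => [//|m IH] /=; case: ifP => [_|/negbT m0]; first by ring.
by rewrite -[RHS]IH; congr (walk_mean m _); apply/funext => a; field; rewrite pnatr_eq0.
Qed.

(** In the recursion, the terms of index 0 and 1 make up the factor
    $1 + c k / m$, the term of index 2 is a source of order $m^{k/2 - 1}$
    carrying the moment of order $k - 2$, and the others are of lower order. *)
Lemma walk_moment_cvg k :
  (fun m => walk_moment k m / Num.sqrt m%:R ^+ k) @ \oo -->
  gaussian_moment (1 - 2 * c)^-1 k.
Proof.
elim/ltn_ind: k => -[_|k IH].
  rewrite [X in X @ _](_ : _ = fun=> 1); last first.
    by apply/funext => m; rewrite /walk_moment walk_mean_cst expr0 divr1.
  by rewrite /gaussian_moment/= expr0 mulr1 divr1; exact: cvg_cst.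
set gm := gaussian_moment _ in IH *.
pose term i m := 'C(k.+1, i)%:R *
    (even_part i * walk_moment (k.+1 - i) m +
     c / m%:R * odd_part i * walk_moment (k.+1 - i).+1 m).
pose l i := 'C(k.+1, i)%:R * (even_part i * (gm (k.+1 - i)%N * (i == 2)%:R)).
have -> : gm k.+1 = (\sum_(2 <= i < k.+2) l i) / (k.+1%:R / 2 - c * k.+1%:R).
  have c0 : 1 - 2 * c != 0 by rewrite gt_eqF//; move: c_half; lra.
  case: k {IH term} @l => [|k] l.
    by rewrite big_geq// mul0r.
  rewrite big_ltn// big_nat_cond big1 ?addr0 => [|i /andP[/andP[i2 _] _]]; last first.
    by rewrite /l (gtn_eqF i2) !mulr0.
  rewrite /l /gm gaussian_momentSS eqxx mulr1 subSS subSS subn0 /even_part sqrrN expr1n.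
  have -> : 'C(k.+2, 2)%:R = k.+2%:R * k.+1%:R / 2 :> R.
    have : ('C(k.+2, 2) * 2 = k.+2 * k.+1)%N.
      by have := bin_ffact k.+2 2; rewrite !ffactnS ffactn0 muln1.
    by move=> /(congr1 (fun n => n%:R : R)); rewrite !natrM => <-; field.
  have h : k.+2%:R / 2 - c * k.+2%:R = k.+2%:R * (1 - 2 * c) / 2 by field.
  by rewrite h; field; rewrite c0 -natrD pnatr_eq0.
apply: (@cvg_linear_recursion _ k.+1 (c * k.+1%:R) _ _
  (fun m => \sum_(2 <= i < k.+2) term i m)).
- rewrite -subr_gt0 (_ : _ - _ = k.+1%:R * (1 / 2 - c)); last by field.
  by rewrite mulr_gt0 ?ltr0n ?subr_gt0.
- move=> m m0; rewrite walk_momentS// big_ltn// big_ltn// addrA.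
  congr (_ + _).
  rewrite bin0 bin1 subn0 subn1 /even_part /odd_part expr0 expr1/=.
  by field; rewrite pnatr_eq0 -lt0n.
have termE m : (0 < m)%N ->
    (\sum_(2 <= i < k.+2) term i m) * m%:R / Num.sqrt m%:R ^+ k.+1 =
    \sum_(i <- index_iota 2 k.+2) 'C(k.+1, i)%:R * (even_part i *
      (walk_moment (k.+1 - i) m / Num.sqrt m%:R ^+ (k.+1 - i) *
       (if i == 2%N then 1 else (Num.sqrt m%:R ^+ (i - 3).+1)^-1)) +
      c * odd_part i * (walk_moment (k.+1 - i).+1 m / Num.sqrt m%:R ^+ (k.+1 - i).+1 *
       (Num.sqrt m%:R ^+ (i - 2).+1)^-1)).
  move=> m0; rewrite !mulr_suml; apply: eq_big_seq => i.
  rewrite mem_index_iota => /andP[i2 ik].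
  have sq : m%:R = Num.sqrt m%:R ^+ 2 :> R by rewrite sqr_sqrtr.
  have z0 := sqrtn0 m0; rewrite /term; set z := Num.sqrt _ in sq z0 *; rewrite sq.
  have -> : z ^+ k.+1 = z ^+ (k.+1 - i) * z ^+ i by rewrite -exprD subnK.
  set a := z ^+ (k.+1 - i); rewrite [z ^+ (k.+1 - i).+1]exprS -/a.
  have a0 : a != 0 by rewrite expf_neq0.
  case: i i2 ik @a a0 => [//|[//|j]] _ _ a a0; rewrite subn2/= !exprS.
  case: j @a a0 => [|j] a a0; first by rewrite eqxx expr0; field; rewrite a0 z0.
  have zj : z ^+ j != 0 by rewrite expf_neq0.
  rewrite (_ : (j.+3 == 2%N) = false) // !subSS subn0 !exprS expr0.
  by field; rewrite a0 z0 zj.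
apply: cvg_trans (_ : (fun m => \sum_(i <- index_iota 2 k.+2) 'C(k.+1, i)%:R * (even_part i *
      (walk_moment (k.+1 - i) m / Num.sqrt m%:R ^+ (k.+1 - i) *
       (if i == 2%N then 1 else (Num.sqrt m%:R ^+ (i - 3).+1)^-1)) +
      c * odd_part i * (walk_moment (k.+1 - i).+1 m / Num.sqrt m%:R ^+ (k.+1 - i).+1 *
       (Num.sqrt m%:R ^+ (i - 2).+1)^-1))) @ \oo --> _).
  apply: near_eq_cvg; near=> m; rewrite termE//.
  by near: m; exact: nbhs_infty_gt.
apply: cvg_sum_seq => i; rewrite mem_index_iota => /andP[i2 ik].
rewrite /l; apply: cvgM; first exact: cvg_cst.
rewrite -[X in _ --> X]addr0 -[X in _ + X](mulr0 (c * odd_part i)); apply: cvgD.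
  apply: cvgM; first exact: cvg_cst.
  apply: cvgM; first by apply: IH; rewrite ltn_subrL (leq_trans _ i2).
  by case: eqP => _; [exact: cvg_cst|exact: cvg_inv_sqrt].
apply: cvgM; first exact: cvg_cst.
rewrite -[X in _ --> X](mulr0 (gm (k.+1 - i).+1)); apply: cvgM; last exact: cvg_inv_sqrt.
by apply: IH; lia.
Unshelve. all: by end_near. Qed.

End elephant_walk.

(** * The joint chain of the position and the number of ones *)

Lemma nat1r_neq0 (R : realType) n : 1 + n%:R != 0 :> R.
Proof. by rewrite nat1r pnatr_eq0. Qed.

Section chain_asymptotics.
Variables (R : realType) (p q r s : R).
Hypothesis hr : 0 < r < 1.
Hypothesis hpqr : p + q + r = 1.
Context d (T : measurableType d) (P : probability T R).
Variable X : nat -> {RV P >-> R}.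
Hypothesis hX : is_ERWS p q r s X.
Implicit Types (n m k : nat) (G H : R -> nat -> R).

Local Notation E n G := (chain_mean X n G).
Local Notation alpha := (p + q).
Local Notation c := ((p - q) / (p + q)).

Let alpha_gt0 : 0 < alpha.
Proof. by have := hpqr; case/andP: hr => *; lra. Qed.

Lemma chain_mean_linear n x G H :
  E n (fun a m => x * G a m + H a m) = x * E n G + E n H.
Proof.
rewrite /chain_mean mulr_sumr -big_split/=; apply: eq_bigr => l _; ring.
Qed.

Lemma chain_meanZ n x G : E n (fun a m => x * G a m) = x * E n G.
Proof. rewrite /chain_mean mulr_sumr; apply: eq_bigr => l _; ring. Qed.

Lemma chain_meanD n G H : E n (fun a m => G a m + H a m) = E n G + E n H.
Proof. by rewrite -[E n G]mul1r -chain_mean_linear; under [RHS]eq_bigr do rewrite mul1r. Qed.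

Lemma chain_meanB n G H : E n (fun a m => G a m - H a m) = E n G - E n H.
Proof.
rewrite -mulN1r -chain_meanZ -chain_meanD; congr (chain_mean X n _).
by apply/funext => a; apply/funext => m; rewrite mulN1r.
Qed.

Lemma chain_mean_cst n x : E n (fun _ _ => x) = x.
Proof. by rewrite /chain_mean -mulr_suml (pr_paths_sum hpqr hX) mul1r. Qed.

(** Zero ones is impossible after the first step and cannot reappear. *)
Lemma chain_mean_no_ones n : E n.+1 (fun _ m => (m == 0%N)%:R) = 0.
Proof.
elim: n => [|n IH]; first by rewrite (chain_mean1 hX) !mulr0 addr0.
rewrite (chain_meanS hpqr hX)// -[RHS]IH; congr (chain_mean X n.+1 _).
apply/funext => a; apply/funext => m; rewrite !mulr0 !add0r.
case: eqP => [->|_]; last by rewrite !mulr0.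
by rewrite mulr0 subr0 mulVf ?mulr1// pnatr_eq0.
Qed.

(** Paths without nonzero step have probability [0], so that inverses of the
    number of ones can be estimated. *)
Lemma le_chain_mean n G H : (0 < n)%N ->
  (forall a m, (0 < m)%N -> G a m <= H a m) -> E n G <= E n H.
Proof.
case: n => [//|n] _ GH; rewrite /chain_mean !big_seq.
apply: ler_sum => l ln; have [ol|ol] := posnP (path_ones l); last first.
  by rewrite ler_wpM2l ?pr_ge0// GH.
suff -> : pr P (path_event X l) = 0 by rewrite !mul0r.
have := chain_mean_no_ones n; rewrite /chain_mean.
move=> /eqP; rewrite psumr_eq0 => [/allP /(_ l ln)|l' _]; last first.
  by rewrite mulr_ge0 ?pr_ge0.
by rewrite /= ol eqxx mulr1 => /eqP.
Qed.

Lemma norm_chain_mean n G : (0 < n)%N -> `|E n G| <= E n (fun a m => `|G a m|).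
Proof.
move=> n0; rewrite ler_norml; apply/andP; split.
  rewrite lerNl -mulN1r -chain_meanZ; apply: le_chain_mean => // a m _.
  by rewrite mulN1r -normrN ler_norm.
by apply: le_chain_mean => // a m _; exact: ler_norm.
Qed.

(** The signs of the nonzero steps form a walk without stops, independent of
    the number of nonzero steps. Indeed averaging out the position by
    [walk_mean] commutes with one step of the chain: given that the step is not
    zero, the remembered step is uniform among the [m] nonzero ones, and is
    kept with probability [p / (p + q)]. *)
Lemma chain_mean_walk n G : E n.+1 G =
  E n.+1 (fun _ m => walk_mean s c m (fun a => G a m)).
Proof.
have a0 : alpha != 0 by rewrite gt_eqF.
elim: n G => [|n IH] G.
  by rewrite !(chain_mean1 hX)/=; ring.
rewrite (chain_meanS hpqr hX)// IH [RHS](chain_meanS hpqr hX)//.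
congr (chain_mean X n.+1 _); apply/funext => a; apply/funext => m.
transitivity (walk_mean s c m (fun a => (n.+1%:R^-1 * (n.+1%:R - alpha * m%:R)) * G a m +
   (alpha * m%:R / n.+1%:R * ((1 + c * a / m%:R) / 2 * G (a + 1) m.+1 +
     (1 - c * a / m%:R) / 2 * G (a - 1) m.+1)))).
  case: m => [|m]; last first.
    congr (walk_mean s c _ _); apply/funext => b.
    by field; rewrite a0 !nat1r_neq0.
  by rewrite /= !(mulr0, subr0, mul0r, addr0, add0r).
rewrite walk_mean_linear walk_meanZ; case: m => [|m].
  by rewrite /= !(mulr0, subr0, mul0r, addr0, add0r); ring.
rewrite -(@walk_meanS R s c m.+1 (fun a => G a m.+2))//.
set w := walk_mean s c m.+2 _; set w' := walk_mean s c m.+1 _.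
by field; rewrite nat1r_neq0.
Qed.

Definition rising k (m : nat) : R := \prod_(i < k) (m + i)%:R.

Lemma rising0 m : rising 0 m = 1. Proof. exact: big_ord0. Qed.

Lemma risingS k m : rising k.+1 m = rising k m * (m + k)%:R.
Proof. exact: big_ord_recr. Qed.

Lemma rising_shift k m : m%:R * rising k m.+1 = rising k m * (m + k)%:R.
Proof.
by rewrite -risingS /rising big_ord_recl addn0; congr (_ * _); apply: eq_bigr => i _; rewrite addSnnS.
Qed.

Lemma rising_ge0 k m : 0 <= rising k m.
Proof. by apply: prodr_ge0 => i _. Qed.

(** The rising factorial is an eigenfunction: as
    [m * rising k m.+1 = (m + k) * rising k m], raising [m] by one with
    probability [(p + q) * m / n] multiplies its mean by
    [1 + k * (p + q) / n]. *)
Lemma chain_mean_rising k n :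
  E n.+1 (fun _ m => rising k m) = k`!%:R * \prod_(i < n) (1 + k%:R * alpha / i.+1%:R).
Proof.
elim: n => [|n IH].
  rewrite (chain_mean1 hX) big_ord0 mulr1.
  have -> : rising k 1 = k`!%:R.
    elim: k => [|k IH]; first by rewrite rising0.
    by rewrite risingS IH factS mulnC natrM add1n.
  by ring.
rewrite (chain_meanS hpqr hX)// big_ord_recr/= mulrA -IH [RHS]mulrC -chain_meanZ.
congr (chain_mean X n.+1 _); apply/funext => a; apply/funext => m.
transitivity (alpha / n.+1%:R * (m%:R * rising k m.+1) + n.+1%:R^-1 * (n.+1%:R - alpha * m%:R) * rising k m).
  by field; rewrite nat1r_neq0.
by rewrite rising_shift natrD; field; rewrite nat1r_neq0.
Qed.

End chain_asymptotics.

(** * Limits of the moments *)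

Section chain_limits.
Variables (R : realType) (p q r s : R).
Hypothesis hr : 0 < r < 1.
Hypothesis hpqr : p + q + r = 1.
Context d (T : measurableType d) (P : probability T R).
Variable X : nat -> {RV P >-> R}.
Hypothesis hX : is_ERWS p q r s X.
Implicit Types (n m k : nat) (G H : R -> nat -> R).

Local Notation E n G := (chain_mean X n G).
Local Notation alpha := (p + q).
Local Notation c := ((p - q) / (p + q)).

Let alpha_gt0 : 0 < alpha.
Proof. by have := hpqr; case/andP: hr => *; lra. Qed.

Let mon G H n := @le_chain_mean R p q r s hpqr d T P X hX n G H.

Lemma chain_meanZr n x G : E n (fun a m => G a m * x) = E n G * x.
Proof.
rewrite mulrC -chain_meanZ; congr (chain_mean X n _).
by apply/funext => a; apply/funext => m; rewrite mulrC.
Qed.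

Definition scale n : R := n%:R `^ alpha.

Lemma scale_gt0 n : (0 < n)%N -> 0 < scale n.
Proof. by move=> n0; rewrite powR_gt0 ?ltr0n. Qed.

Lemma scale_ge0 n : 0 <= scale n. Proof. exact: powR_ge0. Qed.

Lemma scaleX n k : scale n ^+ k = n%:R `^ (k%:R * alpha).
Proof. by rewrite -powR_mulrn ?scale_ge0// mulrC powRrM. Qed.

Lemma scale_cvg : (fun n => (scale n)^-1) @ \oo --> (0 : R).
Proof.
apply/cvgr0Pnorm_le => e e0; near=> n.
have n0 : (0 < n)%N by near: n; exact: nbhs_infty_gt.
rewrite ger0_norm ?invr_ge0 ?scale_ge0// -[leRHS]invrK lef_pV2 ?posrE ?scale_gt0 ?invr_gt0//.
have en : e^-1 `^ alpha^-1 <= n%:R by near: n; exact: nbhs_infty_ger.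
have e1 : 0 <= e^-1 by rewrite invr_ge0 ltW.
have := ge0_ler_powR (ltW alpha_gt0) (powR_ge0 _ _) (ler0n R n) en.
by rewrite -powRrM mulVf ?gt_eqF// powRr1.
Unshelve. all: by end_near. Qed.

Lemma rising_moment_cvg k : (fun n => E n (fun _ m => rising R k m) / scale n ^+ k)
  @ \oo --> k`!%:R / Gamma (1 + k%:R * alpha).
Proof.
have ka : 0 <= k%:R * alpha by rewrite mulr_ge0// ltW.
rewrite -(cvg_shiftS _ _).
apply: cvg_trans (_ : (fun n => k`!%:R *
    ((\prod_(i < n) (1 + k%:R * alpha / i.+1%:R)) / n%:R `^ (k%:R * alpha)) *
    (n%:R / n.+1%:R) `^ (k%:R * alpha)) @ \oo --> _).
  apply: near_eq_cvg; near=> n.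
  have n0 : 0 < n%:R :> R by rewrite ltr0n; near: n; exact: nbhs_infty_gt.
  have n1 : 0 < n.+1%:R :> R by rewrite ltr0n.
  rewrite /= (chain_mean_rising hpqr hX) scaleX.
  rewrite powRM ?invr_ge0 ?(ltW n0)// -(powR_inv1 (ltW n1)) -powRrM mulN1r powRN.
  by field; rewrite !gt_eqF ?powR_gt0.
rewrite -(mulr1 (k`!%:R / Gamma (1 + k%:R * alpha))); apply: cvgM; last first.
  by apply: cvg_powR1; exact: cvg_n_dividedby_succ.
by apply: cvgM; [exact: cvg_cst|exact: cvg_gauss_product].
Unshelve. all: by end_near. Qed.

(** The number of ones tends to infinity. Since it grows with conditional
    probability [(p + q) * m / n], the mean of its inverse contracts by a
    factor at most [1 - (p + q) / (2 * n)]. *)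
Lemma inverse_ones_cvg : (fun n => E n (fun _ m => m%:R^-1)) @ \oo --> (0 : R).
Proof.
rewrite -(cvg_shiftS _ _).
apply: (@cvg_to0_of_contraction _ (alpha / 2) 0).
- by rewrite divr_gt0.
- move=> n; rewrite -[leLHS](chain_mean_cst hpqr hX n.+1 0).
  by apply: mon => // a m m0; rewrite invr_ge0.
move=> n _; rewrite (chain_meanS hpqr hX)// -chain_meanZ.
apply: mon => // a m m0.
have m0' : 0 < m%:R :> R by rewrite ltr0n.
have m1 : 1 <= m%:R :> R by rewrite (ler_nat _ 1).
rewrite -subr_ge0 -[n.+1%:R]natr1 -[m.+1%:R]natr1.
set x : R := n%:R; set y : R := m%:R in m0' m1 *.
have x0 : 0 <= x by [].
rewrite (_ : _ - _ = alpha * (y - 1) / (2 * y * (y + 1) * (x + 1))); last first.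
  by field; rewrite !gt_eqF// ?ltr_wpDl// ltr_pwDr.
apply: divr_ge0; first by rewrite mulr_ge0 ?subr_ge0// ltW.
by rewrite !mulr_ge0 ?addr_ge0// ltW.
Qed.

(** A limit as an estimate for all [m]: the first few terms are paid for by a
    multiple of [1 / m], whose mean over the number of ones vanishes by
    [inverse_ones_cvg]. *)
Lemma near_bound (phi : nat -> R) (l e : R) : phi @ \oo --> l -> 0 < e ->
  exists2 C, 0 <= C & forall m, (0 < m)%N -> `|phi m - l| <= e + C / m%:R.
Proof.
move=> phil e0.
have [M _ hM] := (cvgrPdist_le _ _).1 phil e e0.
pose B := \sum_(i < M) `|phi i - l|.
have B0 : 0 <= B by apply: sumr_ge0.
exists (B * M%:R); first by rewrite mulr_ge0.
move=> m m0; have [Mm|mM] := leqP M m.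
  rewrite distrC; apply: le_trans (hM m Mm) _.
  by rewrite lerDl divr_ge0 ?mulr_ge0.
rewrite ler_wpDl ?(ltW e0)//.
apply: (@le_trans _ _ B).
  by rewrite /B (bigD1 (Ordinal mM))//= lerDl sumr_ge0.
rewrite ler_pdivlMr ?ltr0n// ler_wpM2l// ler_nat; exact: ltnW.
Qed.

Lemma ones_cvg (phi : nat -> R) (l : R) : phi @ \oo --> l ->
  (fun n => E n (fun _ m => phi m)) @ \oo --> l.
Proof.
move=> phil; apply/cvgrPdist_le => e e0.
have [C C0 hC] := near_bound phil (divr_gt0 e0 (ltr0n R 2)).
have : (fun n => C * E n (fun _ m => m%:R^-1)) @ \oo --> (0 : R).
  rewrite -[X in _ --> X](mulr0 C); apply: cvgM; first exact: cvg_cst.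
  exact: inverse_ones_cvg.
move=> /cvgr0Pnorm_le /(_ (e / 2)); rewrite divr_gt0// => /(_ isT) small.
near=> n.
have n0 : (0 < n)%N by near: n; exact: nbhs_infty_gt.
have -> : l - E n (fun _ m => phi m) = - E n (fun _ m => phi m - l).
  by rewrite chain_meanB (chain_mean_cst hpqr hX) opprB.
rewrite normrN; apply: le_trans (norm_chain_mean hpqr hX _ n0) _.
apply: (@le_trans _ _ (E n (fun _ m => e / 2 + C * m%:R^-1))).
  by apply: mon => // a m; exact: hC.
rewrite chain_meanD (chain_mean_cst hpqr hX) (chain_meanZ X n C (fun _ m => m%:R^-1)).
have : `|C * E n (fun _ m => m%:R^-1)| <= e / 2 by near: n.
by move=> /(le_trans (ler_norm _)) h; rewrite [leRHS]splitr lerD2l.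
Unshelve. all: by end_near. Qed.

Lemma rising_pow k : exists2 C : R, 0 <= C & forall m : nat,
  0 <= rising R k.+1 m - m%:R ^+ k.+1 <= C * rising R k m.
Proof.
elim: k => [|k [C C0 IH]].
  exists 0 => // m; rewrite risingS rising0 addn0 mul1r expr1 subrr mul0r.
  by rewrite lexx.
exists (C + k.+1%:R) => [|m]; first by rewrite addr_ge0.
have /andP[IH1 IH2] := IH m.
rewrite risingS [in X in _ - X]exprSr natrD.
have -> : rising R k.+1 m * (m%:R + k.+1%:R) - m%:R ^+ k.+1 * m%:R =
   (rising R k.+1 m - m%:R ^+ k.+1) * m%:R + k.+1%:R * rising R k.+1 m by ring.
apply/andP; split; first by rewrite addr_ge0 ?mulr_ge0 ?rising_ge0.
rewrite [leRHS]mulrDl lerD2r.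
apply: (@le_trans _ _ (C * rising R k m * m%:R)); first by rewrite ler_wpM2r.
by rewrite -mulrA ler_wpM2l// risingS ler_wpM2l ?rising_ge0// ler_nat leq_addr.
Qed.

Lemma power_moment_cvg k : (fun n => E n (fun _ m => m%:R ^+ k) / scale n ^+ k)
  @ \oo --> k`!%:R / Gamma (1 + k%:R * alpha).
Proof.
case: k => [|k].
  apply: cvg_trans (@rising_moment_cvg 0); apply: near_eq_cvg; near=> n.
  congr (chain_mean X n _ / _); apply/funext => a; apply/funext => m.
  by rewrite rising0 expr0.
have [C C0 hC] := rising_pow k.
have diff : (fun n => E n (fun _ m => rising R k.+1 m - m%:R ^+ k.+1) / scale n ^+ k.+1)
    @ \oo --> (0 : R).
  apply: (@squeeze_cvgr _ _ _ _ (fun=> 0)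
    (fun n => C * (E n (fun _ m => rising R k m) / scale n ^+ k) * (scale n)^-1)).
  - near=> n; have n0 : (0 < n)%N by near: n; exact: nbhs_infty_gt.
    have s0 := scale_gt0 n0.
    apply/andP; split.
      apply: divr_ge0; last by rewrite exprn_ge0// ltW.
      rewrite -(chain_mean_cst hpqr hX n 0); apply: mon => // a m _.
      by have /andP[] := hC m.
    rewrite ler_pdivrMr ?exprn_gt0//.
    have -> : C * (E n (fun _ m => rising R k m) / scale n ^+ k) * (scale n)^-1 *
        scale n ^+ k.+1 = C * E n (fun _ m => rising R k m).
      by rewrite exprS; field; rewrite expf_neq0 ?gt_eqF.
    rewrite -(chain_meanZ X n C (fun _ m => rising R k m)); apply: mon => // a m _.
    by have /andP[] := hC m.
  - exact: cvg_cst.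
  - rewrite -[X in _ --> X](mulr0 (C * (k`!%:R / Gamma (1 + k%:R * alpha)))).
    apply: cvgM; last exact: scale_cvg.
    by apply: cvgM; [exact: cvg_cst|exact: rising_moment_cvg].
rewrite -[X in _ --> X]subr0.
apply: cvg_trans (cvgB (@rising_moment_cvg k.+1) diff).
apply: near_eq_cvg; near=> n; rewrite !fctE -mulrBl -chain_meanB.
congr (chain_mean X n _ / _); apply/funext => a; apply/funext => m; ring.
Unshelve. all: by end_near. Qed.

Let sqrt_scale k n m : (0 < n)%N ->
  Num.sqrt m%:R ^+ k / Num.sqrt (scale n) ^+ k <= 1 + m%:R ^+ k / scale n ^+ k :> R.
Proof.
move=> n0; rewrite -!expr_div_n; set z := Num.sqrt m%:R / _.
have z0 : 0 <= z by rewrite divr_ge0 ?sqrtr_ge0.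
have -> : m%:R / scale n = z ^+ 2.
  by rewrite /z expr_div_n !sqr_sqrtr ?scale_ge0.
rewrite -exprM; have [z1|z1] := leP z 1.
  by rewrite ler_wpDr ?exprn_ge0// exprn_ile1.
by rewrite ler_wpDl// ler_weXn2l ?ltW// mul2n -addnn leq_addr.
Qed.

(** By [near_bound] the difference is at most $e m^{(k+1)/2} + C m^{(k-1)/2}$,
    where $m$ is the number of ones. After division by the scale the means of
    these powers are controlled by integer moments. *)
Lemma scaled_ones_cvg k (phi : nat -> R) (l : R) :
  (fun m => phi m / Num.sqrt m%:R ^+ k.+1) @ \oo --> l ->
  (fun n => (E n (fun _ m => phi m) - l * E n (fun _ m => Num.sqrt m%:R ^+ k.+1)) /
     Num.sqrt (scale n) ^+ k.+1) @ \oo --> (0 : R).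
Proof.
move=> phil; apply/cvgr0Pnorm_le => e e0.
pose L : R := k.+1`!%:R / Gamma (1 + k.+1%:R * alpha).
have ka : 0 <= k.+1%:R * alpha by rewrite mulr_ge0// ltW.
have L0 : 0 <= L by rewrite divr_ge0// ltW// Gamma1Dx_gt0.
have e1 : 0 < e / 2 / (2 + L) by rewrite !divr_gt0// ltr_pwDl.
have [C C0 hC] := near_bound phil e1.
pose err n := C * (E n (fun _ m => m%:R^-1) +
   E n (fun _ m => m%:R ^+ k) / scale n ^+ k * (scale n)^-1).
have errc : err @ \oo --> (0 : R).
  rewrite [X in _ --> X](_ : _ = C * (0 + k`!%:R / Gamma (1 + k%:R * alpha) * 0)); last first.
    by rewrite mulr0 addr0 mulr0.
  apply: cvgM; first exact: cvg_cst.
  apply: cvgD; first exact: inverse_ones_cvg.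
  by apply: cvgM; [exact: power_moment_cvg|exact: scale_cvg].
near=> n.
have n0 : (0 < n)%N by near: n; exact: nbhs_infty_gt.
have s0 := scale_gt0 n0.
have err1 : err n <= e / 2.
  by near: n; apply: (cvgr_le (0 : R)) => //; rewrite divr_gt0.
have mk : E n (fun _ m => m%:R ^+ k.+1) / scale n ^+ k.+1 <= L + 1.
  by near: n; apply: (cvgr_le _ (@power_moment_cvg k.+1)); rewrite ltrDl.
set z := Num.sqrt (scale n).
have z0 : 0 < z by rewrite sqrtr_gt0.
rewrite -(chain_meanZ X n l (fun _ m => Num.sqrt m%:R ^+ k.+1)) -chain_meanB.
rewrite normrM [`|_^-1|]ger0_norm ?invr_ge0 ?exprn_ge0 ?(ltW z0)//.
rewrite mulrC; apply: le_trans (ler_wpM2l _ (norm_chain_mean hpqr hX _ n0)) _.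
  by rewrite invr_ge0 exprn_ge0// ltW.
rewrite -(chain_meanZ X n ((z ^+ k.+1)^-1) (fun _ m => `|_|)).
apply: (@le_trans _ _ (e / 2 / (2 + L) * (1 + E n (fun _ m => m%:R ^+ k.+1) / scale n ^+ k.+1) + err n)); last first.
  have : e / 2 / (2 + L) * (1 + E n (fun _ m => m%:R ^+ k.+1) / scale n ^+ k.+1) <=
      e / 2 / (2 + L) * (2 + L).
    by rewrite ler_wpM2l ?(ltW e1)//; lra.
  rewrite divfK; last by rewrite gt_eqF// ltr_pwDl.
  by move=> h; rewrite [leRHS]splitr; exact: lerD.
have -> : e / 2 / (2 + L) * (1 + E n (fun _ m => m%:R ^+ k.+1) / scale n ^+ k.+1) + err n =
  E n (fun _ m => e / 2 / (2 + L) * (1 + m%:R ^+ k.+1 / scale n ^+ k.+1) +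
     C * (m%:R^-1 + m%:R ^+ k / scale n ^+ k.+1)).
  set e' := e / 2 / (2 + L); set sk := (scale n ^+ k.+1)^-1.
  rewrite chain_meanD (chain_meanZ X n e' (fun _ m => 1 + m%:R ^+ k.+1 * sk)).
  rewrite (chain_meanZ X n C (fun _ m => m%:R^-1 + m%:R ^+ k * sk)) !chain_meanD.
  rewrite (chain_mean_cst hpqr hX) (chain_meanZr n sk (fun _ m => m%:R ^+ k.+1)).
  rewrite (chain_meanZr n sk (fun _ m => m%:R ^+ k)) /err.
  by rewrite -mulrA -invfM -exprSr.
apply: mon => // a m m0.
have m0' : 0 < m%:R :> R by rewrite ltr0n.
have sm0 : 0 < Num.sqrt m%:R ^+ k.+1 :> R by rewrite exprn_gt0// sqrtr_gt0.
have -> : phi m - l * Num.sqrt m%:R ^+ k.+1 = (phi m / Num.sqrt m%:R ^+ k.+1 - l) * Num.sqrt m%:R ^+ k.+1.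
  by field; rewrite gt_eqF.
rewrite normrM (gtr0_norm sm0) [leLHS]mulrC -[leLHS]mulrA.
apply: le_trans (ler_wpM2r _ (hC m m0)) _; first by rewrite divr_ge0 ?exprn_ge0 ?(ltW sm0) ?(ltW z0).
have h := sqrt_scale k.+1 m n0; rewrite -/z in h.
rewrite mulrDl; apply: lerD; first by rewrite ler_wpM2l// ltW.
rewrite -mulrA ler_wpM2l//.
apply: (@le_trans _ _ (m%:R^-1 * (1 + m%:R ^+ k.+1 / scale n ^+ k.+1))).
  by rewrite ler_wpM2l// invr_ge0 ltW.
rewrite mulrDr mulr1 lerD2l exprS -!mulrA mulKf// gt_eqF//.
Unshelve. all: by end_near. Qed.

Hypothesis c_half : c < 1 / 2.

Let v := (1 - 2 * c)^-1.

(** By [chain_mean_walk], conditioning on the number of ones reduces this to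
    the moments of the walk without stops at a time that tends to infinity. *)
Lemma self_normalised_moment_cvg k :
  (fun n => E n (fun a m => (a / Num.sqrt m%:R) ^+ k)) @ \oo --> gaussian_moment v k.
Proof.
apply: cvg_trans (ones_cvg (walk_moment_cvg s c_half (k := k))).
apply: near_eq_cvg; near=> n.
have n0 : (0 < n)%N by near: n; exact: nbhs_infty_gt.
rewrite -(prednK n0) [in RHS](chain_mean_walk hr hpqr hX); congr (chain_mean X _ _).
apply/funext => _; apply/funext => m; rewrite /walk_moment mulrC -walk_meanZ.
by congr (walk_mean _ _ _ _); apply/funext => a; rewrite expr_div_n mulrC.
Unshelve. all: by end_near. Qed.

(** Odd Gaussian moments vanish, so that only integer moments of the number of
    ones survive in the limit. *)
Lemma walk_moment_chain_cvg k :
  (fun n => E n (fun _ m => walk_moment s c k m) / Num.sqrt (scale n) ^+ k) @ \oo -->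
  gaussian_moment v k * ((k./2)`!%:R / Gamma (1 + (k./2)%:R * alpha)).
Proof.
case: k => [|k].
  rewrite /gaussian_moment/= expr0 divr1 mul0r addr0 Gamma1 divr1 !mulr1.
  rewrite [X in X @ _](_ : _ = fun=> 1); first exact: cvg_cst.
  apply/funext => n; rewrite expr0 divr1 -[RHS](chain_mean_cst hpqr hX n).
  congr (chain_mean X n _); apply/funext => _; apply/funext => m.
  by rewrite /walk_moment walk_mean_cst.
set g := gaussian_moment _ _.
have h := scaled_ones_cvg (walk_moment_cvg s c_half (k := k.+1)).
suff h2 : (fun n => g * (E n (fun _ m => Num.sqrt m%:R ^+ k.+1) / Num.sqrt (scale n) ^+ k.+1))
    @ \oo --> g * ((k.+1./2)`!%:R / Gamma (1 + (k.+1./2)%:R * alpha)).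
  rewrite -[X in _ --> X]add0r; apply: cvg_trans (cvgD h h2).
  apply: near_eq_cvg; near=> n; rewrite !fctE -[gaussian_moment _ _]/g; ring.
have [ko|ke] := boolP (odd k.+1).
  have g0 : g = 0 by rewrite /g /gaussian_moment ko.
  rewrite g0 mul0r [X in X @ _](_ : _ = fun=> 0); first exact: cvg_cst.
  by apply/funext => n; rewrite mul0r.
apply: cvgM; first exact: cvg_cst.
have kE : k.+1 = (2 * k.+1./2)%N by rewrite mul2n even_halfK.
apply: cvg_trans (@power_moment_cvg k.+1./2); apply: near_eq_cvg; near=> n.
rewrite [in RHS]kE exprM sqr_sqrtr ?scale_ge0//.
congr (chain_mean X n _ / _); apply/funext => _; apply/funext => m.
by rewrite exprM sqr_sqrtr.
Unshelve. all: by end_near. Qed.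

Lemma scaled_moment_cvg k :
  (fun n => E n (fun a m => (a / Num.sqrt (scale n)) ^+ k)) @ \oo -->
  gaussian_moment v k * ((k./2)`!%:R / Gamma (1 + (k./2)%:R * alpha)).
Proof.
apply: cvg_trans (@walk_moment_chain_cvg k); apply: near_eq_cvg; near=> n.
have n0 : (0 < n)%N by near: n; exact: nbhs_infty_gt.
have W G : E n G = E n (fun _ m => walk_mean s c m (fun a => G a m)).
  by rewrite -(prednK n0) [LHS](chain_mean_walk hr hpqr hX).
rewrite -chain_meanZr [in RHS]W.
congr (chain_mean X _ _).
apply/funext => _; apply/funext => m; rewrite /walk_moment mulrC -walk_meanZ.
by congr (walk_mean _ _ _ _); apply/funext => a; rewrite expr_div_n mulrC.
Unshelve. all: by end_near. Qed.

End chain_limits.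

(** * Mittag-Leffler variables *)

Section mittag_leffler_moments.
Context (R : realType).
Implicit Types (a : nat -> R) (b t : R).

(** Comparing with the bound at $2b$ gains a factor $2^{-k}$. *)
Lemma exponentially_bounded_cvg0 a :
  (forall b, 0 <= b -> exists C, forall k, b ^+ k * `|a k| <= C) ->
  forall b, (fun k => b ^+ k * a k) @ \oo --> 0.
Proof.
move=> ha b; have [C hC] := ha (2 * `|b|) (mulr_ge0 (ler0n R 2) (normr_ge0 b)).
apply/norm_cvg0P.
have C0 : (fun k => C * (2^-1) ^+ k) @ \oo --> 0.
  rewrite -(mulr0 C); apply: cvgM; first exact: cvg_cst.
  by apply: cvg_expr; rewrite ger0_norm ?invr_ge0// invf_lt1 ?ltr1n.
apply: (squeeze_cvgr _ (cvg_cst 0) C0); apply: nearW => k /=.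
rewrite normr_ge0 /= exprVn ler_pdivlMr ?exprn_gt0//.
by apply: le_trans (hC k); rewrite exprMn normrM normrX mulrC mulrA.
Qed.

Lemma partial_sum_le_geometric (c : nat -> R) t j i :
  (forall k, 0 <= c k <= 2) -> 0 <= t <= 2^-1 ->
  \sum_(j <= k < j + i) t ^+ k * c k <= 4 * t ^+ j - 4 * t ^+ (j + i).
Proof.
move=> hc /andP[t0 th]; elim: i => [|i IH].
  by rewrite addn0 big_geq// subrr.
rewrite addnS big_nat_recr ?leq_addr//=.
have ci : t ^+ (j + i) * c (j + i)%N <= 2 * t ^+ (j + i).
  by have /andP[_ ?] := hc (j + i)%N; rewrite mulrC ler_wpM2r ?exprn_ge0.
apply: le_trans (lerD IH ci) _.
rewrite exprS; have := exprn_ge0 (j + i) t0; have : t * t ^+ (j + i) <= 2^-1 * t ^+ (j + i).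
  by rewrite ler_wpM2r// exprn_ge0.
lra.
Qed.

(** For [t <= 2^-1] the tail is at most twice a geometric series of ratio
    [2^-1]. *)
Lemma power_series_taylor (c : nat -> R) t j :
  (forall k, 0 <= c k <= 2) -> 0 <= t <= 2^-1 ->
  `|limn (series (fun k => t ^+ k * c k)) - \sum_(k < j) c k * t ^+ k| <= 4 * t ^+ j.
Proof.
move=> hc ht; have /andP[t0 th] := ht.
pose u k := t ^+ k * c k.
have u0 k : 0 <= u k by rewrite mulr_ge0 ?exprn_ge0//; have /andP[] := hc k.
have nd : {homo series u : n m / (n <= m)%N >-> n <= m}.
  by apply/nondecreasing_seqP => n; rewrite /series/= big_nat_recr//= lerDl.
have ub n : (j <= n)%N -> series u n <= series u j + 4 * t ^+ j.
  move=> /subnKC <-; rewrite /series /= (big_cat_nat _ (leq_addr _ j))//= lerD2l.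
  apply: le_trans (partial_sum_le_geometric _ _ hc ht) _.
  by rewrite lerBlDr lerDl mulr_ge0// exprn_ge0.
have cu : cvgn (series u).
  apply: (nondecreasing_is_cvgn nd); exists (series u j + 4 * t ^+ j) => _ [n _ <-].
  apply: le_trans (ub (maxn j n) (leq_maxl _ _)); apply: nd; exact: leq_maxr.
rewrite (_ : \sum_(k < j) _ = series u j); last first.
  by rewrite /series/= big_mkord; apply: eq_bigr => k _; rewrite mulrC.
rewrite ger0_norm ?subr_ge0; last exact: nondecreasing_cvgn_le.
rewrite lerBlDl; apply: limr_le => //.
by exists j => // n /= jn; exact: ub.
Qed.

Context d (T : measurableType d) (P : probability T R).
Variables (alpha : R) (Y : {RV P >-> R}).
Hypothesis alpha0 : 0 <= alpha.
Hypothesis mlY : mittag_leffler alpha Y.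

(** The defining series is its own asymptotic expansion at [0], and so is the
    series of the moments: their coefficients agree. *)
Lemma mittag_leffler_moment k :
  \int[P]_w (Y w ^+ k) = k`!%:R / Gamma (1 + k%:R * alpha).
Proof.
pose c (k : nat) : R := (Gamma (1 + k%:R * alpha))^-1.
have hc i : 0 <= c i <= 2.
  have h : 0 <= i%:R * alpha by rewrite mulr_ge0.
  have G0 := Gamma1Dx_gt0 h.
  rewrite invr_ge0 ltW//= -[leRHS]invrK lef_pV2 ?posrE ?invr_gt0//.
  exact: Gamma1Dx_ge_half.
have rho0 : 0 < 2^-1 :> R by rewrite invr_gt0.
rewrite -/(c k); suff e : c =1 (fun k => \int[P]_w (Y w ^+ k) / k`!%:R).
  by rewrite (e k) mulrC divfK// pnatr_eq0 -lt0n fact_gt0.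
apply: (taylor_coefficients_unique rho0 (m := fun t => limn (series (fun n => t ^+ n * c n)))) => J.
  exists 4 => t /andP[t0 th]; apply: power_series_taylor => //.
  by rewrite ltW.
have [C hC] := mgf_taylor mlY J.*2.
exists C => t /andP[t0 th]; have tn : `|t| <= 1.
  by rewrite gtr0_norm//; lra.
by have := hC t tn; rewrite (gtr0_norm t0).
Qed.

End mittag_leffler_moments.

Section moment_growth.
Context (R : realType) d (T : measurableType d) (P : probability T R).
Variables (Y : {RV P >-> R}) (m : R -> R).
Hypothesis mgfE : forall t, 'M_P Y t = (m t)%:E.

Lemma mgf_moment_decay (b : R) :
  (fun k => b ^+ k * (\int[P]_w (Y w ^+ k) / k`!%:R)) @ \oo --> 0.
Proof.
apply: exponentially_bounded_cvg0 => {}b b0.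
have [C hC] := moment_exponential_bound mgfE b0; exists C => k.
rewrite normrM mulrA [X in _ * X <= _]ger0_norm ?invr_ge0//; exact: hC.
Qed.

Lemma cvg_double : (fun K => K.*2) @ \oo --> \oo.
Proof. by move=> A [N _ NA]; exists N => // n /= Nn; apply: NA => /=; lia. Qed.

Lemma mgf_moments_growth t :
  (fun K => t ^+ K.*2 / (K.*2)`!%:R * \int[P]_w (Y w ^+ K.*2)) @ \oo --> 0.
Proof.
rewrite [X in X @ _](_ : _ =
  (fun k => t ^+ k * (\int[P]_w (Y w ^+ k) / k`!%:R)) \o double).
  exact: cvg_comp cvg_double (mgf_moment_decay t).
by apply/funext => K /=; rewrite mulrAC mulrA.
Qed.

End moment_growth.

Section chain_is_mean.
Context (R : realType) (p q r s : R).
Hypothesis hpqr : p + q + r = 1.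
Context d (T : measurableType d) (P : probability T R).
Variable X : nat -> {RV P >-> R}.
Hypothesis hX : is_ERWS p q r s X.

Lemma chain_mean_is_mean n (G : R -> nat -> R) :
  is_mean (fun h => chain_mean X n (fun a m => h (G a m))).
Proof.
split=> [a f g|f g fg|]; first exact: chain_mean_linear.
  by apply: ler_sum => l _; rewrite ler_wpM2l ?pr_ge0.
exact: (chain_mean_cst hpqr hX).
Qed.

Hypothesis hr : 0 < r < 1.
Context d' (T' : measurableType d') (P' : probability T' R).
Variable Y : {RV P' >-> R}.
Hypothesis mlY : mittag_leffler (p + q) Y.

Let alpha0 : 0 <= p + q.
Proof. by have := hpqr; case/andP: hr => *; lra. Qed.

(** The Mittag-Leffler variable is, by its moments, the limit in law of the
    nonnegative rescaled number of ones. *)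
Lemma mittag_leffler_ge0 : {ae P', forall w, 0 <= Y w}.
Proof.
(* Bounded, continuous, and positive exactly on the negative numbers. *)
pose f (x : R) := Num.max 0 (Num.min (- x) 1).
have f0 x : 0 <= f x by rewrite le_max lexx.
have f1 x : f x <= 1 by rewrite ge_max ler01 /= ge_min lexx orbT.
have cf : continuous f.
  move=> x; have cN : {for x, continuous (fun y : R^o => - y)}.
    by apply: continuousN; exact: cvg_id.
  have cx (a : R) : {for x, continuous (fun _ : R^o => a : R^o)} by exact: cst_continuous.
  exact: (continuous_max (cx 0) (continuous_min cN (cx 1))).
have mY : measurable_fun setT Y by exact: measurable_funP.
have [mf If cvgf] : mean_cvg P' (fun n h => chain_mean X n.+1 (fun _ m => h (m%:R / scale p q n.+1))) Y f.
  apply: (method_of_moments (fun n => chain_mean_is_mean n.+1 (fun _ m => m%:R / scale p q n.+1))) => //.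
  - move=> k; split; first exact: measurable_funX.
      exact: (moment_integrable mlY).
    rewrite (mittag_leffler_moment alpha0 mlY).
    have := power_moment_cvg hr hpqr hX (k := k).
    rewrite -cvg_shiftS; apply: cvg_trans; apply: near_eq_cvg; near=> n.
    rewrite /= mulrC -chain_meanZ; congr (chain_mean X n.+1 _).
    apply/funext => a; apply/funext => m.
    by rewrite exprMn exprVn mulrC.
  - exact: (mgf_moments_growth mlY).
  - by exists 1 => x; rewrite ger0_norm.
have f0n : (fun n => chain_mean X n.+1 (fun _ m => f (m%:R / scale p q n.+1))) = cst 0.
  apply/funext => n; rewrite -[RHS](chain_mean_cst hpqr hX n.+1 0).
  congr (chain_mean X n.+1 _); apply/funext => a; apply/funext => m.
  apply/max_idPl; rewrite ge_min oppr_le0 divr_ge0//.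
  exact: scale_ge0.
have int0 : \int[P']_w f (Y w) = 0.
  rewrite f0n in cvgf.
  exact: (cvg_unique _ cvgf (cvg_cst 0)).
have : (\int[P']_w `|(EFin \o (f \o Y)) w| = 0)%E.
  under eq_integral => w _ do rewrite /= ger0_norm//.
  by rewrite -(fineK (integrable_fin_num measurableT If)) -[fine _]/(\int[P']_w f (Y w)) int0.
have mfY : measurable_fun setT (EFin \o (f \o Y)) by case/integrableP: If.
move/(ae_eq_integral_abs P' measurableT mfY); apply: filterS => w /(_ I) /= [] fw0.
rewrite leNgt; apply/negP => Y0; have : 0 < f (Y w).
  by rewrite lt_max lt_min oppr_gt0 Y0 ltr01 orbT.
by rewrite fw0 ltxx.
Unshelve. all: by end_near.
Qed.
End chain_is_mean.

(** * Independence *)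

Section independence.
Context (R : realType) d (T : measurableType d) (P : probability T R).
Variables (Y Z : {RV P >-> R}).
Hypothesis indep : independent_RV Y Z.

Local Notation mu := (distribution P Y \x distribution P Z)%E.
Let YZ (w : T) : R * R := (Y w, Z w).

Let mYZ : measurable_fun setT YZ.
Proof. by apply: measurable_fun_pair; exact: measurable_funP. Qed.

HB.instance Definition _ := isMeasurableFun.Build _ _ _ _ YZ mYZ.
Let JYZ : {RV P >-> (R * R)%type} := YZ.

(** Both measures agree on rectangles, which determine a finite measure. *)
Lemma independent_joint_law (A : set (R * R)) : measurable A ->
  mu A = distribution P JYZ A.
Proof.
move=> mA; apply: (product_measure_unique (m' := distribution P JYZ)) mA => B C mB mC.
exact: indep.
Qed.

Lemma ge0_integral_independent (f g : R -> \bar R) :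
  measurable_fun setT f -> measurable_fun setT g ->
  (forall x, 0 <= f x)%E -> (forall x, 0 <= g x)%E ->
  (\int[P]_w (f (Y w) * g (Z w)) = \int[P]_w f (Y w) * \int[P]_w g (Z w))%E.
Proof.
move=> mf mg f0 g0.
pose h (z : R * R) := (f z.1 * g z.2)%E.
have mh : measurable_fun setT h.
  by apply: emeasurable_funM; apply: measurableT_comp.
have h0 z : (0 <= h z)%E by rewrite mule_ge0.
have -> : (\int[P]_w (f (Y w) * g (Z w)) = \int[mu]_z h z)%E.
  rewrite -(ge0_integral_distribution JYZ mh h0).
  by apply: eq_measure_integral => A mA _; exact: esym (independent_joint_law mA).
rewrite fubini_tonelli1// /fubini_F /=.
under eq_integral => x _ do rewrite /h/= ge0_integralZl//.
rewrite ge0_integralZr//; last exact: integral_ge0.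
by rewrite !ge0_integral_distribution.
Qed.

(** Tonelli's theorem gives the integrability of the product and Fubini's
    theorem its integral, once the joint law is a product. *)
Lemma Rintegral_independent (f g : R -> R) :
  measurable_fun setT f -> measurable_fun setT g ->
  P.-integrable setT (EFin \o (f \o Y)) -> P.-integrable setT (EFin \o (g \o Z)) ->
  P.-integrable setT (EFin \o (fun w => f (Y w) * g (Z w))) /\
  \int[P]_w (f (Y w) * g (Z w)) = (\int[P]_w f (Y w)) * \int[P]_w g (Z w).
Proof.
move=> mf mg If Ig.
pose h (z : R * R) := (f z.1 * g z.2)%:E.
have mh : measurable_fun setT h.
  by apply/measurable_EFinP; apply: measurable_funM; apply: measurableT_comp.
have Ih : P.-integrable setT (h \o JYZ).
  apply/integrableP; split; first exact: measurableT_comp.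
  rewrite (_ : (\int[P]_w _ = \int[P]_w (`|(f (Y w))%:E| * `|(g (Z w))%:E|))%E); last first.
    by apply: eq_integral => w _; rewrite /= normrM EFinM.
  rewrite (ge0_integral_independent (f := fun x => `|(f x)%:E|%E)
    (g := fun x => `|(g x)%:E|%E))//; last 2 first.
  - by apply: measurableT_comp => //; exact/measurable_EFinP.
  - by apply: measurableT_comp => //; exact/measurable_EFinP.
  rewrite lte_mul_pinfty ?integral_ge0//; last by case/integrableP: Ig.
  exact: (integrable_fin_num measurableT (integrable_abse If)).
split; first exact: Ih.
have Im : mu.-integrable setT h.
  apply/integrableP; split => //.
  have mah : measurable_fun setT (fun z => `|h z|%E) by exact: measurableT_comp.
  have := ge0_integral_distribution JYZ mah (fun z => abse_ge0 (h z)).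
  rewrite (eq_measure_integral mu); last by move=> A mA _; exact: esym (independent_joint_law mA).
  by move=> ->; case/integrableP: Ih.
rewrite /Rintegral.
have -> : (\int[P]_w (f (Y w) * g (Z w))%:E = \int[mu]_z h z)%E.
  rewrite (_ : (\int[P]_w _ = \int[P]_w (h \o JYZ) w)%E)//.
  rewrite -integral_distribution//.
  by apply: eq_measure_integral => A mA _; exact: esym (independent_joint_law mA).
have Eg : (\int[distribution P Z]_z (g z)%:E = \int[P]_w (g (Z w))%:E)%E.
  by rewrite integral_distribution//; exact/measurable_EFinP.
have Ef : (\int[distribution P Y]_z (f z)%:E = \int[P]_w (f (Y w))%:E)%E.
  by rewrite integral_distribution//; exact/measurable_EFinP.
rewrite -integral12_prod_meas1// /fubini_F /=.
have Ig' : (distribution P Z).-integrable setT (EFin \o g).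
  by apply: integrable_pushforward => //; exact/measurable_EFinP.
have If' : (distribution P Y).-integrable setT (EFin \o f).
  by apply: integrable_pushforward => //; exact/measurable_EFinP.
under eq_integral => x _ do rewrite /h/= (eq_integral (fun y => (f x)%:E * (g y)%:E)%E)// integralZl//.
rewrite Eg -(fineK (integrable_fin_num measurableT Ig)) integralZr// Ef fineM//.
exact: integrable_fin_num.
Qed.
End independence.

(** * Gaussian mixtures and convergence in law *)

Section gaussian_mixture.
Context (R : realType) d (T : measurableType d) (P : probability T R).
Variables (alpha s : R) (Y N : {RV P >-> R}).
Hypothesis alpha0 : 0 <= alpha.
Hypothesis s0 : s != 0.
Hypothesis mlY : mittag_leffler alpha Y.
Hypothesis Y0 : {ae P, forall w, 0 <= Y w}.
Hypothesis lawN : has_law N (normal_prob 0 s).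
Hypothesis indep : independent_RV Y N.

Let mY : measurable_fun setT Y. Proof. exact: measurable_funP. Qed.

Lemma measurable_sqrt : measurable_fun setT (@Num.sqrt R).
Proof. by apply: continuous_measurable_fun; exact: sqrt_continuous. Qed.

Let measurable_sqrtX k : measurable_fun setT (fun x : R => Num.sqrt x ^+ k).
Proof. apply: measurable_funX; exact: measurable_sqrt. Qed.

Let integrable_sqrtX k : P.-integrable setT (EFin \o (fun w => Num.sqrt (Y w) ^+ k)).
Proof.
have I1 : P.-integrable setT (EFin \o cst (1 : R)).
  by apply: finite_measure_integrable_cst.
have := integrableD measurableT I1 (integrable_norm (moment_integrable mlY k)).
apply: le_integrable => //.
  by apply/measurable_EFinP; apply: (measurableT_comp (measurable_sqrtX k)).
move=> w _ /=; rewrite lee_fin ger0_norm ?exprn_ge0 ?sqrtr_ge0//.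
apply: le_trans (ler_norm _); have [Yw|Yw] := leP 0 (Y w); last first.
  rewrite ler0_sqrtr ?(ltW Yw)// expr0n; case: eqP => _ /=; last by rewrite addr_ge0.
  by rewrite lerDl.
rewrite normrX (ger0_norm Yw); have [s1|s1] := leP (Num.sqrt (Y w)) 1.
  by rewrite (le_trans (exprn_ile1 k (sqrtr_ge0 _) s1))// lerDl exprn_ge0.
rewrite (@le_trans _ _ (Y w ^+ k)) ?lerDr// -[in leRHS](sqr_sqrtr Yw) -exprM mulnC.
by rewrite ler_eXn2l ?(ltW s1)//; lia.
Qed.

Let even_sqrt_moment j :
  \int[P]_w (Num.sqrt (Y w) ^+ j.*2) = \int[P]_w (Y w ^+ j).
Proof.
congr fine; apply: ae_eq_integral => //.
- by apply/measurable_EFinP; exact: (measurableT_comp (measurable_sqrtX j.*2)).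
- by apply/measurable_EFinP; exact: measurable_funX.
- by apply: filterS Y0 => w Yw _; rewrite -mul2n exprM sqr_sqrtr.
Qed.

Let normal_integrable k := moment_integrable (normal_mgf s0 lawN) k.

(** For odd [k] the Gaussian factor vanishes; for even [k] the power of the
    square root is an integer power of the mixing variable. *)
Lemma gaussian_mixture_moment k :
  P.-integrable setT (EFin \o (fun w => (Num.sqrt (Y w) * N w) ^+ k)) /\
  \int[P]_w ((Num.sqrt (Y w) * N w) ^+ k) =
    gaussian_moment (s ^+ 2) k * ((k./2)`!%:R / Gamma (1 + (k./2)%:R * alpha)).
Proof.
have mX : measurable_fun setT (fun x : R => x ^+ k) by exact: measurable_funX.
have [I1 E1] := Rintegral_independent indep (measurable_sqrtX k) mX
  (integrable_sqrtX k) (normal_integrable k).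
have e : (fun w => (Num.sqrt (Y w) * N w) ^+ k) = (fun w => Num.sqrt (Y w) ^+ k * N w ^+ k).
  by apply/funext => w; rewrite exprMn.
rewrite e; split; first exact: I1.
rewrite E1 (normal_moment s0 lawN) mulrC -(mittag_leffler_moment alpha0 mlY).
rewrite /gaussian_moment; case: ifPn => kodd; first by rewrite !mul0r.
congr (_ * _); rewrite -even_sqrt_moment.
by rewrite -[in LHS](odd_double_half k) (negbTE kodd).
Qed.

(** Multiplying by the square root of the mixing variable turns its moments of
    order $K$ into moments of order $2K$, and the Gaussian factor contributes
    $(2K)!/K!$: the Taylor coefficients are those of the mixing variable. *)
Lemma gaussian_mixture_moments_growth t :
  (fun K => t ^+ K.*2 / (K.*2)`!%:R * \int[P]_w ((Num.sqrt (Y w) * N w) ^+ K.*2))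
    @ \oo --> 0.
Proof.
apply: cvg_trans (mgf_moment_decay mlY (t ^+ 2 * s ^+ 2 / 2)).
apply: near_eq_cvg; near=> K.
rewrite (gaussian_mixture_moment _).2 (mittag_leffler_moment alpha0 mlY).
rewrite /gaussian_moment odd_double doubleK -mul2n exprM.
rewrite [(t ^+ 2 * s ^+ 2 / 2) ^+ K](_ : _ = (s ^+ 2 / 2) ^+ K * (t ^+ 2) ^+ K); last first.
  by rewrite -[RHS]exprMn; congr (_ ^+ _); ring.
have f1 : K`!%:R != 0 :> R by rewrite pnatr_eq0 -lt0n fact_gt0.
have f2 : (2 * K)`!%:R != 0 :> R by rewrite pnatr_eq0 -lt0n fact_gt0.
have G0 : Gamma (1 + K%:R * alpha) != 0 by rewrite gt_eqF// Gamma1Dx_gt0// mulr_ge0.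
by field; rewrite f1 f2 G0.
Unshelve. all: by end_near.
Qed.

End gaussian_mixture.

Section convergence_in_law.
Context (R : realType) (p q r s : R).
Hypothesis hpqr : p + q + r = 1.
Context d (T : measurableType d) (P : probability T R).
Variable X : nat -> {RV P >-> R}.
Hypothesis hX : is_ERWS p q r s X.
Context d' (T' : measurableType d') (P' : probability T' R).

(** The expectations of the statement are finite sums over paths, to which
    [method_of_moments] applies. *)
Lemma walk_cvg_in_law (G : nat -> R -> R -> R) (Z : T' -> R) :
  (forall n, measurable_fun setT
    (fun w => G n (position X n w) (number_of_ones X n w))) ->
  measurable_fun setT Z ->
  (forall k, P'.-integrable setT (EFin \o (fun w => Z w ^+ k))) ->
  (forall k, (fun n => chain_mean X n (fun a m => G n a m%:R ^+ k)) @ \oo -->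
    \int[P']_w (Z w ^+ k)) ->
  (forall t, (fun K => t ^+ K.*2 / (K.*2)`!%:R * \int[P']_w (Z w ^+ K.*2))
    @ \oo --> 0) ->
  cvg_in_law P (fun n w => G n (position X n w) (number_of_ones X n w)) P' Z.
Proof.
move=> mG mZ IZ cvgZ growZ f cf [M fM].
have [mf If cvgf] : mean_cvg P' (fun n h => chain_mean X n (fun a m => h (G n a m%:R))) Z f.
  apply: method_of_moments => //; last by exists M.
  - by move=> n; exact: (chain_mean_is_mean hpqr hX).
  - by move=> k; split; [exact: measurable_funX|exact: IZ|exact: cvgZ].
have EZ : ('E_P'[f \o Z] = (\int[P']_w f (Z w))%:E)%E.
  by rewrite unlock /Rintegral fineK//; exact: integrable_fin_num.
have En n : ('E_P[f \o (fun w => G n (position X n w) (number_of_ones X n w))] =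
    (chain_mean X n (fun a m => f (G n a m%:R)))%:E)%E.
  have IG : P.-integrable setT (EFin \o (fun w => f (G n (position X n w) (number_of_ones X n w)))).
    apply: measurable_bounded_integrable => //.
    - by rewrite (le_lt_trans (probability_le1 P measurableT))// ltry.
    - exact: (measurableT_comp mf (mG n)).
    - exists M; split; first exact: num_real.
      by move=> x Mx w _; exact: le_trans (fM _) (ltW Mx).
  rewrite -(Rintegral_chain_mean hpqr hX (h := fun a b => f (G n a b)) IG).
  by rewrite unlock /Rintegral fineK//; exact: integrable_fin_num.
rewrite EZ; under eq_fun => n do rewrite En.
apply: cvg_EFin; [exact: nearW|exact: cvgf].
Qed.

Lemma measurable_fun_div_sqrt (T0 : measurableType d) (D : set T0) (f g : T0 -> R) :
  (forall w, 0 <= g w) -> measurable_fun D f -> measurable_fun D g ->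
  measurable_fun D (fun w => f w / Num.sqrt (g w)).
Proof.
move=> g0 mf mg; apply: measurable_funM => //.
(* Real powers are measurable on the whole line, and the equality also holds
   where [g w] is [0]. *)
rewrite (_ : (fun w => _) = (fun w => (g w `^ (2^-1)) `^ (-1))).
  apply: (measurableT_comp (measurable_powR _)).
  exact: (measurableT_comp (measurable_powR _)).
by apply/funext => w; rewrite powR12_sqrt// powR_inv1// sqrtr_ge0.
Qed.

End convergence_in_law.

(** * Diffusive limits of the walk with stops *)

Theorem theorem3p3 (R : realType) (p q r s : R)
    (hp : 0 <= p <= 1) (hq : 0 <= q <= 1) (hr : 0 < r < 1)
    (hpqr : p + q + r = 1) (hs : 0 <= s <= 1)
    (d : measure_display) (T : measurableType d) (P : probability T R)
    (X : nat -> {RV P >-> R}) (hX : is_ERWS p q r s X)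
    (hdiff : p / (1 - r) < 3 / 4) :
  (forall (d' : measure_display) (T' : measurableType d')
      (P' : probability T' R) (N : {RV P' >-> R}),
    has_law N (normal_prob 0 (Num.sqrt (sigma2 p r))) ->
    cvg_in_law P
      (fun n w => position X n w / Num.sqrt (number_of_ones X n w))
      P' N)
  /\
  (forall (d' : measure_display) (T' : measurableType d')
      (P' : probability T' R) (Sigma' N : {RV P' >-> R}),
    mittag_leffler (1 - r) Sigma' ->
    has_law N (normal_prob 0 (Num.sqrt (sigma2 p r))) ->
    independent_RV Sigma' N ->
    cvg_in_law P
      (fun n w => position X n w / Num.sqrt (n%:R `^ (1 - r)))
      P' (fun w => Num.sqrt (Sigma' w) * N w)).
Proof.
have [r0 r1] := andP hr.
have alphaE : p + q = 1 - r by lra.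
have a0 : 0 < 1 - r by lra.
pose c := (p - q) / (p + q).
have qE : q = 1 - r - p by lra.
have hp' : 4 * p < 3 * (1 - r).
  by move: hdiff; rewrite ltr_pdivrMr//; lra.
have c_half : c < 1 / 2.
  by rewrite /c alphaE ltr_pdivrMr//; lra.
have v0 : 0 < (1 - 2 * c)^-1 by rewrite invr_gt0; lra.
have vE : Num.sqrt (sigma2 p r) ^+ 2 = (1 - 2 * c)^-1.
  rewrite (_ : sigma2 p r = (1 - 2 * c)^-1) ?sqr_sqrtr ?ltW//.
  rewrite /sigma2 /c alphaE qE; field.
  by apply/andP; split; [|rewrite gt_eqF//; lra]; rewrite gt_eqF//; lra.
have s0 : Num.sqrt (sigma2 p r) != 0.
  by rewrite -sqrf_eq0 vE gt_eqF.
have mpos n := measurable_position X n.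
have mones n := measurable_number_of_ones X n.
split=> [d' T' P' N lawN|d' T' P' Sigma' N mlS lawN indep].
- have mgfN := normal_mgf s0 lawN.
  apply: (walk_cvg_in_law hpqr hX (G := fun _ a m => a / Num.sqrt m)) => //.
  + move=> n; apply: measurable_fun_div_sqrt => // w.
    by apply: sumr_ge0 => k _; exact: sqr_ge0.
  + by move=> k; exact: moment_integrable mgfN _.
  + by move=> k; rewrite (normal_moment s0 lawN) vE; exact: (self_normalised_moment_cvg hr hpqr hX c_half).
  + exact: mgf_moments_growth mgfN.
- rewrite -alphaE in mlS *.
  have S0 := mittag_leffler_ge0 hpqr hX hr mlS.
  have aa : 0 <= p + q by rewrite alphaE ltW.
  have mm k := gaussian_mixture_moment aa s0 mlS S0 lawN indep k.
  apply: (walk_cvg_in_law hpqr hX (G := fun n a _ => a / Num.sqrt (scale p q n))).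
  + by move=> n; apply: measurable_funM.
  + apply: measurable_funM => //.
    by apply: measurableT_comp => //; exact: measurable_sqrt.
  + by move=> k; case: (mm k).
  + by move=> k; rewrite (mm k).2 vE; exact: (scaled_moment_cvg hr hpqr hX c_half).
  + by move=> t; exact: (gaussian_mixture_moments_growth aa s0 mlS S0 lawN indep t).
Qed.
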